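(* Consider the Hawkes-fed infinite-server queue with excitation function $h:[0,\infty)\to[0,\infty)$, nonnegative mark $B$ and nonnegative service requirement $J$. Fix $t>0$ and let $F(u,k):=\mathbb{P}(S(u)\le k)$ for $0\le u\le t$, $k\in\mathbb{N}$. With $\tilde\phi$ the operator on (possibly defective) time-dependent CDFs on the nonnegative integers defined in the context, let $F^\ast\equiv1$, $F_\ast\equiv0$, and let $F^{n\ast}:=\tilde\phi^{[n]}(F^\ast)$ and $F_{n\ast}:=\tilde\phi^{[n]}(F_\ast)$ be the $n$-fold applications. Then for every $0\le u\le t$ and all $n,k\in\mathbb{N}$, $$1=F^\ast(u,k)\ge F^{n\ast}(u,k)\ge F^{(n+1)\ast}(u,k)\ge F(u,k)\ge F_{(n+1)\ast}(u,k)\ge F_{n\ast}(u,k)\ge F_\ast(u,k)=0.$$ Here $F^{n\ast}$ and $F_{n\ast}$ are the (possibly defective) CDFs whose $z$-transforms are $\phi^{[n]}(1)$ and $\phi^{[n]}(0)$, respectively, i.e. the $n$-fold applications of $\phi$ to the functions identically equal to $1$ and $0$, where $$\phi(f)(u,z)=\big(\mathbb{P}(J\le u)+\mathbb{P}(J>u)z\big)\,\beta\left(\int_0^uh(s)(1-f(u-s,z))\,\mathrm ds\right),\qquad \beta(s)=\mathbb{E}e^{-sB}.$$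
   Context: $h$ is locally integrable. Cluster: an individual with mark $B$ gives birth to children according to an inhomogeneous Poisson process with rate $Bh(v)$ at age $v$ (conditionally on $B$); every child independently has its own mark (an independent copy of $B$) and produces children in the same way, and so on. Each individual enters an infinite-server system at its birth and stays for an independent time distributed as $J\ge0$. $S(u)$ is the number of members of the cluster started by one individual (the individual itself and all its descendants) that are present in the system $u$ time units after that individual's birth. It satisfies, for $0\le u\le t$, $S(u)\stackrel{d}{=}\mathbf 1_{\{J>u\}}+\sum_{i=1}^{K(u)}S^{(i)}(u-t_i)$, where $K(\cdot)$ is the counting process of the individual's children, with birth times $t_1,t_2,\dots$ and (given $B$) rate $Bh(\cdot)$, and the $S^{(i)}$ are independent copies of $S$. Operator: a possibly defective time-dependent CDF is a function $F(u,k)$, $0\le u\le t$, $k\in\mathbb{N}$ (nonnegative integers), that for each $u$ is of the form $\mathbb{P}(X(u)\le k)$ with $X(u)$ valued in $\{0,1,2,\dots\}\cup\{\infty\}$; its $z$-transform is $\sum_{k\ge0} z^k\,\mathbb{P}(X(u)=k)$. Define $$\tilde\phi(F)(u,k)=\mathbb{P}\left(\mathbf 1_{\{J>u\}}+\sum_{i=1}^{K(u)}S^{(i)}(u-t_i)\le k\right),\qquad 0\le u\le t,$$ where the $S^{(i)}$ are i.i.d., independent of $J$, $B$, $K$ and the birth times, with $S^{(i)}(v)$ having possibly defective CDF $F(v,\cdot)$, $K(\cdot)$ is the counting process of the children of one individual with mark $B$ (conditionally on $B$, an inhomogeneous Poisson counting process with rate $Bh(\cdot)$), and $t_1,t_2,\dots$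 are the birth times of these children, i.e. the event times of $K(\cdot)$. *)

(* Defs.v *)
From HB Require Import structures.
From mathcomp Require Export all_boot all_order all_algebra.
From mathcomp Require Export all_classical all_reals all_analysis.
From mathcomp Require Export measurable_realfun.
Set Implicit Arguments.
Unset Strict Implicit.
Unset Printing Implicit Defensive.
Import Order.TTheory GRing.Theory Num.Theory.
Import numFieldNormedType.Exports.
Local Open Scope classical_set_scope.
Local Open Scope ring_scope.

Definition locally_integrable_half_line (R : realType) (h : R -> R) : Prop :=
  forall a : R, 0 <= a ->
    (@lebesgue_measure R).-integrable `[0, a]%classic (EFin \o h).

(** * Independence *)

Definition sigma_rv d dE (Omega : measurableType d) (E : measurableType dE)
    (X : Omega -> E) : set (set Omega) :=
  preimage_set_system [set: Omega] X measurable.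

Definition mutually_independent d (Omega : measurableType d) (R : realType)
    (P : probability Omega R) (I : eqType) (G : I -> set (set Omega)) : Prop :=
  forall (s : seq I) (A : I -> set Omega), uniq s ->
    (forall i, i \in s -> G i (A i)) ->
    P (\bigcap_(i in [set` s]) A i) = (\prod_(i <- s) P (A i))%E.

Definition same_law d dE (Omega : measurableType d) (E : measurableType dE)
    (R : realType) (P : probability Omega R) (X Y : Omega -> E) : Prop :=
  forall A : set E, measurable A -> P (X @^-1` A) = P (Y @^-1` A).

(** * One individual

  [J] is the service requirement, [B] the mark and [T i] the age of the
  individual at the birth of its child number [i] (counted from 0, in order of
  birth); [T i = +oo] when there are at most [i] children. *)

Section Individual.
Context d (Omega : measurableType d) (R : realType) (P : probability Omega R).
Implicit Types (h : R -> R) (J B : Omega -> R) (T : nat -> Omega -> \bar R).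

Definition children_count T (u : R) (w : Omega) : \bar R :=
  (\sum_(0 <= i <oo) ((T i w <= u%:E)%E%:R : R)%:E)%E.

(* The library's [poisson_pmf] takes the value 1 at rate 0 for every [n]; rate 0
   does occur here, and there the law has to be the Dirac mass at 0. *)
Definition poisson_mass (r : R) (n : nat) : R :=
  expR (- r) * r ^+ n / n`!%:R.

(* Given [B], the process counting the points [T] has independent increments,
   the one over ]a, b] being Poisson with parameter [B * \int_a^b h]. The
   conditioning is spelled out by integrating over the events [B \in A]. *)
Definition conditionally_poisson h B T : Prop :=
  forall (A : set R) (m : nat) (s : nat -> R) (n : nat -> nat),
    measurable A -> s 0%N = 0 -> {homo s : i j / (i <= j)%N >-> i <= j} ->
    P (B @^-1` A `&`
       [set w | children_count T 0 w = 0%E /\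
          forall j, (j < m)%N ->
            children_count T (s j.+1) w
              = (children_count T (s j) w + ((n j)%:R : R)%:E)%E]) =
    (\int[P]_(w in B @^-1` A)
       (\prod_(j < m)
          poisson_mass
            (B w * \int[lebesgue_measure]_(x in `[s j, s j.+1]) h x)
            (n j))%:E)%E.

Definition sigma_births B T : set (set Omega) :=
  <<s sigma_rv B `|` \bigcup_i sigma_rv (T i) >>.

Definition sigma_individual J B T : set (set Omega) :=
  <<s sigma_rv J `|` (sigma_rv B `|` \bigcup_i sigma_rv (T i)) >>.

Definition individual h J B T : Prop :=
  [/\ measurable_fun [set: Omega] J /\ measurable_fun [set: Omega] B,
      (forall i, measurable_fun [set: Omega] (T i)),
      (forall w, 0 <= J w) /\ (forall w, 0 <= B w),
      (forall w, (forall i, (0 <= T i w)%E) /\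
         {homo T ^~ w : i j / (i <= j)%N >-> (i <= j)%E})
    & conditionally_poisson h B T /\
      (forall A C : set Omega, sigma_rv J A -> sigma_births B T C ->
         P (A `&` C) = (P A * P C)%E)].

End Individual.

(** * The cluster

  Individuals are labelled by finite sequences: [[::]] is the ancestor and
  [rcons v i] is child number [i] of [v]; [Tv v] are the ages of [v] at the
  births of its children. *)

Section Cluster.
Context d (Omega : measurableType d) (R : realType) (P : probability Omega R).
Variables (h : R -> R) (J B : Omega -> R).
Variables (Jv Bv : seq nat -> Omega -> R).
Variable (Tv : seq nat -> nat -> Omega -> \bar R).

Definition cluster : Prop :=
  [/\ forall v, individual P h (Jv v) (Bv v) (Tv v),
      forall v, same_law P (Jv v) J /\ same_law P (Bv v) B
    & mutually_independent P
        (fun v => sigma_individual (Jv v) (Bv v) (Tv v))].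

Definition birth_time (v : seq nat) (w : Omega) : \bar R :=
  (\sum_(0 <= j < size v) Tv (take j v) (nth 0%N v j) w)%E.

Definition in_system (v : seq nat) (u : R) (w : Omega) : bool :=
  (birth_time v w <= u%:E)%E && (u%:E < birth_time v w + (Jv v w)%:E)%E.

(* [S u]; the value [+oo] is not excluded, since nothing is assumed on the
   moments of [B]. *)
Definition cluster_size (u : R) (w : Omega) : \bar R :=
  (\esum_(v in [set: seq nat]) ((in_system v u w)%:R : R)%:E)%E.

Definition cluster_cdf (u : R) (k : nat) : R :=
  fine (P [set w | (cluster_size u w <= (k%:R : R)%:E)%E]).

End Cluster.

(** * Possibly defective time-dependent CDFs *)

Definition extended_nat (R : realType) : set (\bar R) :=
  [set x | x = +oo%E \/ exists k : nat, x = (k%:R)%:E].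

Definition defective_cdf (R : realType) (F : nat -> R) : Prop :=
  exists (d : measure_display) (Omega : measurableType d)
         (P : probability Omega R) (X : Omega -> \bar R),
    [/\ measurable_fun [set: Omega] X,
        (forall w, extended_nat (X w))
      & (forall k, (F k)%:E = P [set w | (X w <= (k%:R : R)%:E)%E])].

(* Measurability in [u] is what gives a meaning to a process with marginal CDFs
   [F u] evaluated at a random time, as in [phi_tilde]. *)
Definition td_cdf (R : realType) (t : R) (F : R -> nat -> R) : Prop :=
  (forall u, 0 <= u <= t -> defective_cdf (F u)) /\
  (forall k, measurable_fun `[0, t]%classic (F ^~ k)).

Definition cdf_mass (R : realType) (F : nat -> R) (k : nat) : R :=
  if k is k'.+1 then F k - F k' else F 0%N.

Definition has_z_transform (R : realType) (F : nat -> R) (z l : R) : Prop :=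
  series (fun k => z ^+ k * cdf_mass F k) @ \oo --> l.

(** * The operator on time-dependent CDFs

  The i.i.d. processes with marginal CDFs [F v] are given as
  [v |-> g F (v, xi i w)] with [xi i] i.i.d. random elements of a measurable
  space [E], independent of the individual [(J, B, T)]. Joint measurability of
  [g F] in the time and in the process's own source of randomness [xi i] is
  essential: with joint measurability in [(v, w)] only, independence of the
  variables at deterministic times would not determine the law of
  [S^(i)(u - t_i)]. The map [g] is otherwise arbitrary; for instance, [xi i] may
  be uniform on [0, 1] and [g F (v, _)] the quantile function of [F v]. *)

Section PhiTilde.
Context d dE (Omega : measurableType d) (E : measurableType dE).
Context (R : realType) (P : probability Omega R).
Variables (J B : Omega -> R) (T : nat -> Omega -> \bar R).
Variables (xi : nat -> Omega -> E).
Variable (g : (R -> nat -> R) -> R * E -> \bar R).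

Definition iid_sources : Prop :=
  [/\ forall i, measurable_fun [set: Omega] (xi i),
      forall i, same_law P (xi i) (xi 0%N)
    & mutually_independent P
        (fun o : option nat => if o is Some i then sigma_rv (xi i)
                               else sigma_individual J B T)].

Definition process_with_cdf (t : R) (F : R -> nat -> R) : Prop :=
  [/\ measurable_fun (`[0, t]%classic `*` [set: E]) (g F),
      (forall v x, 0 <= v <= t -> extended_nat (g F (v, x)))
    & (forall v i k, 0 <= v <= t ->
         P [set w | (g F (v, xi i w) <= (k%:R : R)%:E)%E] = (F v k)%:E)].

Definition phi_tilde (F : R -> nat -> R) (u : R) (k : nat) : R :=
  fine (P [set w | (((u < J w)%R%:R : R)%:E +
                    \sum_(0 <= i <oo | T i w <= u%:E)
                       g F (u - fine (T i w), xi i w)%R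
                    <= (k%:R : R)%:E)%E]).

End PhiTilde.

(** * The operator on transforms *)

Section Phi.
Context d (Omega : measurableType d) (R : realType) (P : probability Omega R).
Variables (h : R -> R) (J B : Omega -> R).

Definition laplace (s : R) : R :=
  fine ('E_P[fun w => expR (- (s * B w))])%E.

Definition phi (f : R -> R -> R) (u z : R) : R :=
  (fine (P [set w | J w <= u]) + fine (P [set w | u < J w]) * z) *
  laplace (\int[lebesgue_measure]_(s in `[0, u]) (h s * (1 - f (u - s) z))).

End Phi.

(* Main.v *)
(** Conditionally on its mark, the children of an individual form a
  Poisson process, so that
  [E (prod over births tau <= u of f (u - tau)) = E exp (- B \int_0^u h (1 - f))];
  hence [phi] describes the effect of [phi_tilde] on z-transforms. Truncate the
  cluster at generation [n]: every member of generation [n] born in time counts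
  for [0], resp. for [+oo]. The truncated clusters satisfy the same recursion
  as the iterates, hence have the same z-transforms, and a possibly defective
  cdf is determined by its z-transform on ]0, 1[. So the iterates are the cdfs
  of the truncated clusters, for which the inequalities hold pathwise. *)

From HB Require Import structures.
Require Import Defs.
From mathcomp Require Import ring lra.
Import Order.TTheory GRing.Theory Num.Theory.
Import numFieldNormedType.Exports.
Local Open Scope classical_set_scope.
Local Open Scope ring_scope.
Set Implicit Arguments.
Unset Strict Implicit.
Unset Printing Implicit Defensive.

(** * Integrals of bounded functions and independence *)

(** The law of the births is given only through counts on finite grids, so the exponential formula
    has to be built up: for [f] constant on the cells of a grid it is a computation with Poisson
    masses, and it passes to all bounded measurable [f] because these are reached from step
    functions by repeated limits at every point. The infinite products over births obstruct such
    limits; they are therefore cut at the first [M] births, with an error governed by the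
    probability that birth number [M] happens in time, whatever [f] is. Nothing is assumed on the
    joint law of the randomness behind the iterates and that of the cluster, so the two can only be
    compared in law. What they share is that the contribution of a child is independent of all birth
    times: freezing these, child by child, turns the mean of a power of [z] into the mean of a
    product over the births. The value +oo contributes 0 to a transform, so defective laws need no
    separate treatment. *)

Lemma cvg_norm_le (R : realType) (a : nat -> R) (l b : R) : a @ \oo --> l ->
  (forall n, `|a n| <= b) -> `|l| <= b.
Proof.
move=> al ab; have cv : `|a n| @[n --> \oo] --> `|l| by exact: cvg_norm.
move/cvg_lim : (cv) => <-//; apply: limr_le; first by apply/cvg_ex; eexists; exact: cv.
exact: nearW.
Qed.

Lemma Rintegral_sum d (X : measurableType d) (R : realType)
    (mu : {measure set X -> \bar R}) (I : Type) (s : seq I) (F : I -> X -> R) :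
  (forall i, mu.-integrable setT (EFin \o F i)) ->
  \int[mu]_x (\sum_(i <- s) F i x) = \sum_(i <- s) \int[mu]_x F i x.
Proof.
move=> iF; elim: s => [|i s IH].
  rewrite big_nil; under eq_Rintegral do rewrite big_nil.
  by rewrite /Rintegral integral0.
rewrite big_cons -IH; under eq_Rintegral do rewrite big_cons.
rewrite RintegralD//.
elim: s {IH} => [|j s IH].
  by under eq_fun do rewrite big_nil; exact: integrable0.
under eq_fun do rewrite big_cons.
exact: (integrableD measurableT (iF j) IH).
Qed.

Section bounded.
Context d (Omega : measurableType d) (R : realType) (P : probability Omega R).
Implicit Types f g : Omega -> R.

Lemma bounded_integrable f (M : R) : measurable_fun setT f -> (forall w, `|f w| <= M) ->
  P.-integrable setT (EFin \o f).
Proof.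
move=> mf fM; apply: measurable_bounded_integrable => //.
  by apply: (le_lt_trans (probability_le1 P measurableT)); rewrite ltry.
by exists M; split; [exact: num_real|move=> x Mx w _; exact: le_trans (fM w) (ltW Mx)].
Qed.

Lemma Rintegral_bounded f (M : R) : measurable_fun setT f -> (forall w, `|f w| <= M) ->
  (\int[P]_w (f w)%:E = (\int[P]_w f w)%R%:E)%E.
Proof.
move=> mf fM; rewrite /Rintegral fineK//.
by apply: integrable_fin_num => //; exact: bounded_integrable fM.
Qed.

Lemma Rintegral_cst_prob (r : R) : \int[P]_w r = r.
Proof.
by rewrite [LHS](Rintegral_cst P measurableT r) [X in fine X](probability_setT P) mulr1.
Qed.

Lemma integrable_indic_prob A : measurable A ->
  P.-integrable setT (EFin \o (\1_A : Omega -> R)).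
Proof.
move=> mA; apply: (@bounded_integrable _ 1) => // w.
by rewrite indicE normr_nat lern1 leq_b1.
Qed.

Lemma Rintegral_indic A : measurable A -> \int[P]_w (\1_A w) = fine (P A).
Proof. by move=> mA; rewrite /Rintegral integral_indic// setIT. Qed.

Lemma Rintegral_le_bound f (M : R) : measurable_fun setT f -> (forall w, `|f w| <= M) ->
  `|\int[P]_w f w| <= M.
Proof.
move=> mf fM; have fi := bounded_integrable mf fM.
apply: (le_trans (le_normr_Rintegral _ fi)) => //.
apply: (@le_trans _ _ (\int[P]_w cst M w)).
  apply: le_Rintegral => //.
  - by apply: (@bounded_integrable _ M) => [|w]; [exact: measurableT_comp|rewrite normr_id].
  - by apply: (@bounded_integrable _ `|M|).
by rewrite Rintegral_cst_prob.
Qed.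

Lemma bounded_cvg_Rintegral (f_ : nat -> Omega -> R) f (M : R) :
  (forall n, measurable_fun setT (f_ n)) ->
  (forall n w, `|f_ n w| <= M) ->
  (forall w, f_ ^~ w @ \oo --> f w) ->
  (\int[P]_w f_ n w) @[n --> \oo] --> \int[P]_w f w.
Proof.
move=> mf_ f_M f_f.
have mf : measurable_fun setT f by apply: measurable_fun_cvg => // w _; exact: f_f.
have [|||||_ _ h] := @dominated_convergence _ _ _ P setT measurableT
  (fun n w => (f_ n w)%:E) (EFin \o f) (EFin \o cst M).
- by move=> n; apply/measurable_EFinP; exact: mf_.
- exact/measurable_EFinP.
- by apply: aeW => w _; apply: cvg_EFin; [exact: nearW|exact: f_f].
- by apply: (@bounded_integrable _ `|M|) => //; exact: measurable_cst.
- by apply: aeW => w n _; rewrite lee_fin.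
have fM w : `|f w| <= M by apply: (cvg_norm_le (f_f w)) => n; exact: f_M.
have h' : fine (\int[P]_w (f_ n w)%:E)%E @[n --> \oo] --> fine (\int[P]_w (f w)%:E)%E.
  apply: fine_cvg; rewrite fineK; first exact: h.
  by apply: integrable_fin_num => //; exact: (bounded_integrable mf fM).
exact: h'.
Qed.

(** The integrands differ by at most 2, and only on [A]. Every truncation error below has this form:
    [A] is the event that birth number [M] happens in time, up to a null set. *)
Lemma Rintegral_diff_le f g A : measurable_fun setT f -> measurable_fun setT g ->
  (forall w, `|f w| <= 1) -> (forall w, `|g w| <= 1) -> measurable A ->
  (forall w, ~ A w -> f w = g w) ->
  `|\int[P]_w f w - \int[P]_w g w| <= 2 * fine (P A).
Proof.
move=> mf mg f1 g1 mA fg.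
have fi := bounded_integrable mf f1; have gi := bounded_integrable mg g1.
rewrite -RintegralB//.
have mB : measurable_fun setT (f \- g) by exact: measurable_funB.
have B2 w : `|(f \- g) w| <= 2.
  by rewrite /= (le_trans (ler_normB _ _))// (natrD _ 1 1) lerD.
apply: (le_trans (le_normr_Rintegral _ (bounded_integrable mB B2))) => //.
have m1 : measurable_fun setT (fun w => 2 * \1_A w : R).
  by apply: measurable_funM => //; exact: measurable_indic.
apply: (@le_trans _ _ (\int[P]_w (2 * \1_A w))).
  apply: le_Rintegral => //.
  - by apply: (@bounded_integrable _ 2) => [|w]; [exact: measurableT_comp|rewrite normr_id].
  - apply: (@bounded_integrable _ 2) => // w.
    by rewrite normrM indicE normr_nat ger0_norm// ler_piMr// lern1 leq_b1.
  - move=> w _; rewrite indicE; have [wA|wA] := boolP (w \in A).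
      by rewrite mulr1; exact: B2.
    rewrite /= mulr0 fg ?subrr ?normr0//.
    by move=> Aw; move/negP: wA; apply; rewrite inE.
by rewrite RintegralZl ?Rintegral_indic//; exact: integrable_indic_prob.
Qed.

End bounded.

(** * Fubini's theorem for independent random elements *)

Section independence.
Context d (Omega : measurableType d) (R : realType) (P : probability Omega R).

(** The law of [(X, Y)] and the product of the marginal laws agree on rectangles, hence everywhere.
    The codomains are arbitrary so that [Omega] itself, with a smaller sigma-algebra and [X] the
    identity, can be used. *)
Lemma indep_fubini d1 d2 (E1 : measurableType d1) (E2 : measurableType d2)
   (X : Omega -> E1) (Y : Omega -> E2) (H : E1 * E2 -> R) (M : R) :
  measurable_fun setT X -> measurable_fun setT Y ->
  (forall A1 A2, measurable A1 -> measurable A2 ->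
     P (X @^-1` A1 `&` Y @^-1` A2) = (P (X @^-1` A1) * P (Y @^-1` A2))%E) ->
  measurable_fun setT H -> (forall x, `|H x| <= M) ->
  \int[P]_w H (X w, Y w) = \int[P]_w \int[P]_w' H (X w, Y w').
Proof.
move=> mX mY indep mH HM.
pose X' : {mfun Omega >-> E1} := HB.pack X (isMeasurableFun.Build _ _ _ _ X mX).
pose Y' : {mfun Omega >-> E2} := HB.pack Y (isMeasurableFun.Build _ _ _ _ Y mY).
have mXY : measurable_fun setT (fun w => (X w, Y w)) by exact: measurable_fun_pair.
pose XY : {mfun Omega >-> (E1 * E2)%type} :=
  HB.pack (fun w => (X w, Y w)) (isMeasurableFun.Build _ _ _ _ _ mXY).
pose m1 := distribution P X'; pose m2 := distribution P Y'.
have prodE A : measurable A -> (m1 \x m2)%E A = distribution P XY A.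
  by move=> mA; apply: product_measure_unique => // A1 A2 mA1 mA2; exact: indep.
have iH : (m1 \x m2)%E.-integrable setT (EFin \o H).
  apply: measurable_bounded_integrable => //.
  - rewrite [ltLHS](prodE _ measurableT).
    apply: (le_lt_trans (probability_le1 (distribution P XY) measurableT)).
    by rewrite ltry.
  - exists M; split; first exact: num_real.
    by move=> x Mx w _; exact: le_trans (HM w) (ltW Mx).
rewrite /Rintegral; congr fine.
transitivity (\int[distribution P XY]_x (H x)%:E)%E.
  rewrite integral_distribution//; first exact/measurable_EFinP.
  apply: (@bounded_integrable _ _ _ P (fun w => H (X w, Y w)) M) => //.
  exact: measurableT_comp.
transitivity (\int[(m1 \x m2)%E]_x (H x)%:E)%E.
  by apply: eq_measure_integral => A mA _; exact/esym/prodE.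
rewrite -[LHS](integral12_prod_meas1 iH).
have FE x : fubini_F m2 (EFin \o H) x = (\int[P]_w' H (x, Y w'))%:E.
  rewrite /fubini_F integral_distribution.
  - apply: (@Rintegral_bounded _ _ _ P (fun w => H (x, Y w)) M) => //.
    by apply: measurableT_comp => //; exact: measurable_fun_pair.
  - by apply: measurableT_comp => //; exact/measurable_EFinP.
  - apply: (@bounded_integrable _ _ _ P (fun w => H (x, Y w)) M) => //.
    by apply: measurableT_comp => //; exact: measurable_fun_pair.
have mF := measurable_fubini_F iH.
rewrite integral_distribution.
- by apply: eq_integral => w _ /=; rewrite FE.
- exact: mF.
- rewrite (_ : _ \o _ = EFin \o (fun w => \int[P]_w' H (X w, Y w'))); last first.
    by apply/funext => w /=; rewrite FE.
  apply: (@bounded_integrable _ _ _ P _ M).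
    apply/measurable_EFinP; rewrite (_ : _ \o _ = fubini_F m2 (EFin \o H) \o X).
      by apply: measurableT_comp.
    by apply/funext => w /=; rewrite FE.
  move=> w; apply: Rintegral_le_bound => //.
  by apply: measurableT_comp => //; exact: measurable_fun_pair.
Qed.

End independence.

(** * Independence of generated sigma-algebras *)

Section independent_sigma_algebras.
Context d (Omega : measurableType d) (R : realType) (P : probability Omega R).

Definition independent_systems (G1 G2 : set (set Omega)) :=
  forall A C, G1 A -> G2 C -> P (A `&` C) = (P A * P C)%E.

(** With [C] fixed, both sides are finite measures in [A] that agree on the intersection-stable
    system [G1] and have the same total mass, so uniqueness of measures applies. *)
Lemma independent_systems_sigmal (G1 G2 : set (set Omega)) :
  G1 `<=` measurable -> G2 `<=` measurable -> setI_closed G1 -> G1 setT ->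
  independent_systems G1 G2 -> independent_systems <<s G1>> G2.
Proof.
move=> G1m G2m G1I G1T ind A C sA GC.
have mC := G2m _ GC.
have PC0 : 0 <= fine (P C) by rewrite fine_ge0.
pose m1 : {measure set Omega -> \bar R} := mrestr P mC.
pose m2 : {measure set Omega -> \bar R} := mscale (NngNum PC0) P.
have -> : P (A `&` C) = m1 A by [].
have m2E X : m2 X = (P X * P C)%E.
  by rewrite /m2 /= /mscale /= muleC fineK// fin_num_measure.
rewrite -m2E.
apply: (g_sigma_algebra_measure_unique G1 _ (fun=> setT)) => //.
- by rewrite bigcup_const//; exists 0%N.
- by move=> B GB; rewrite m2E; exact: ind.
- move=> _; rewrite (_ : m1 setT = P C)//; last by rewrite /m1 /= /mrestr setTI.
  by apply: (le_lt_trans (probability_le1 P mC)); rewrite ltry.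
Qed.

Lemma independent_systems_sym G1 G2 :
  independent_systems G1 G2 -> independent_systems G2 G1.
Proof. by move=> ind A C GA GC; rewrite setIC muleC; exact: ind. Qed.

Lemma sigma_sub_measurable (G : set (set Omega)) :
  G `<=` measurable -> <<s G>> `<=` measurable.
Proof. exact: smallest_sub (@sigma_algebra_measurable _ Omega). Qed.

Lemma independent_systems_sigma (G1 G2 : set (set Omega)) :
  G1 `<=` measurable -> G2 `<=` measurable ->
  setI_closed G1 -> G1 setT -> setI_closed G2 -> G2 setT ->
  independent_systems G1 G2 -> independent_systems <<s G1>> <<s G2>>.
Proof.
move=> G1m G2m I1 T1 I2 T2 ind.
apply: independent_systems_sigmal => //; first exact: sigma_sub_measurable.
apply: independent_systems_sym; apply: independent_systems_sigmal => //.
exact: independent_systems_sym.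
Qed.

Section grouping.
Variables (I : choiceType) (G : I -> set (set Omega)).
Hypothesis Gs : forall i, sigma_algebra setT (G i).
Hypothesis Gm : forall i, G i `<=` measurable.

Let GT i : G i setT.
Proof. by have [G0 GD _] := Gs i; rewrite -(setD0 setT); exact: GD. Qed.

Let GI i : setI_closed (G i).
Proof.
have := Gs i; move=> [G0 GC GU] A B GA GB.
rewrite -[A `&` B]setCK setCI -setTD; apply: (GC).
rewrite -bigcup2E; apply: GU => -[|[|n]]; rewrite /bigcup2 /= -?setTD //.
- exact: GC.
- exact: GC.
Qed.

(** An intersection-stable system generating the sigma-algebra of the group [D]. The family [A] is
    defined for all indices and equal to [setT] off [s], so that two members intersect index by
    index over the union of their index lists. *)
Definition finite_intersections (D : pred I) : set (set Omega) :=
  [set C | exists s : seq I, exists A : I -> set Omega,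
    [/\ uniq s, {subset s <= D}, (forall i, G i (A i)),
        (forall i, i \notin s -> A i = setT) & C = \bigcap_(i in [set` s]) A i]].

Lemma finite_intersections_setI D : setI_closed (finite_intersections D).
Proof.
move=> _ _ [s [A [us sD GA AT ->]]] [s' [A' [us' sD' GA' AT' ->]]].
exists (undup (s ++ s')), (fun i => A i `&` A' i); split.
- exact: undup_uniq.
- by move=> i; rewrite mem_undup mem_cat => /orP[/sD|/sD'].
- by move=> i; exact: GI.
- by move=> i; rewrite mem_undup mem_cat negb_or => /andP[/AT-> /AT'->]; rewrite setTI.
- apply/seteqP; split => [w [h h'] i _|w h].
    split.
      by have [is_|/AT->//] := boolP (i \in s); exact: h.
    by have [is_|/AT'->//] := boolP (i \in s'); exact: h'.
  by split => i /= is_; have [] := h i; rewrite /= ?mem_undup ?mem_cat ?is_ ?orbT.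
Qed.

Lemma finite_intersectionsT D : finite_intersections D setT.
Proof.
exists [::], (fun=> setT); split => //.
by apply/seteqP; split => // w _ i; rewrite /= in_nil.
Qed.

Lemma finite_intersections_measurable D : finite_intersections D `<=` measurable.
Proof.
move=> _ [s [A [us sD GA AT ->]]]; apply: fin_bigcap_measurable => //.
by move=> i _; apply: Gm; exact: GA.
Qed.

Lemma sub_finite_intersections (D : pred I) :
  \bigcup_(i in [set i | D i]) G i `<=` finite_intersections D.
Proof.
move=> A [i Di GA]; exists [:: i], (fun j => if j == i then A else setT); split => //.
- by move=> j; rewrite inE => /eqP->.
- by move=> j; case: eqP => [->//|_]; exact: GT.
- by move=> j; rewrite inE => /negPf->.
- apply/seteqP; split => [w Aw j /=|w /(_ i)/=]; rewrite ?inE ?eqxx.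
    by move=> /eqP->; rewrite eqxx.
  exact.
Qed.

(** Mutual independence is applied to a single list, the concatenation of two disjoint index lists,
    and the product is split again; the resulting independence of two intersection-stable systems
    passes to the sigma-algebras they generate. *)
Lemma independent_groups (D D' : pred I) : (forall i, D i -> ~~ D' i) ->
  mutually_independent P G ->
  independent_systems <<s \bigcup_(i in [set i | D i]) G i>>
                      <<s \bigcup_(i in [set i | D' i]) G i>>.
Proof.
move=> DD' ind A C sA sC.
have h : independent_systems <<s finite_intersections D>> <<s finite_intersections D'>>.
  apply: independent_systems_sigma; try exact: finite_intersections_measurable;
    try exact: finite_intersections_setI; try exact: finite_intersectionsT.
  move=> _ _ [s [B [us sD GB BT ->]]] [s' [B' [us' sD' GB' BT' ->]]].
  pose B'' i := if i \in s then B i else B' i.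
  have dss' i : i \in s' -> i \notin s.
    by move=> /sD' D'i; apply/negP => /sD /DD'; rewrite [D' i]D'i.
  have -> : \bigcap_(i in [set` s]) B i `&` \bigcap_(i in [set` s']) B' i =
            \bigcap_(i in [set` s ++ s']) B'' i.
    rewrite /B''; apply/seteqP; split => [w [h h'] i|w h].
      by rewrite /= mem_cat; case: ifPn => [is_ _|is_ /= is']; [exact: h|exact: h'].
    split => i /= is_.
      by have := h i; rewrite /= mem_cat is_ => /(_ isT).
    by have := h i; rewrite /= mem_cat is_ orbT (negPf (dss' _ is_)) => /(_ isT).
  rewrite ind; last 2 first.
  - rewrite cat_uniq us us' andbT /=; apply/hasPn => i; exact: dss'.
  - by move=> i _; rewrite /B''; case: ifP.
  rewrite big_cat /= ind// ind//; congr (_ * _)%E.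
    by rewrite big_seq [RHS]big_seq; apply: eq_bigr => i is_; rewrite /B'' is_.
  rewrite big_seq [RHS]big_seq; apply: eq_bigr => i is_.
  by rewrite /B'' (negPf (dss' _ is_)).
apply: h.
- by apply: sub_sigma_algebra2 sA; exact: sub_finite_intersections.
- by apply: sub_sigma_algebra2 sC; exact: sub_finite_intersections.
Qed.

End grouping.
End independent_sigma_algebras.

(** * z-transforms *)

Section z_transforms.
Context (R : realType).
Implicit Types (z : R) (x y : \bar R).

(* The contribution [z ^ x] of the value [x] of a count to its z-transform; the
   value [+oo] contributes 0, even for [z = 1]. Only meant for extended naturals. *)
Definition zpow z x : R := if x is r%:E then z ^+ Num.truncn r else 0.

Lemma zpow_nat z k : zpow z (k%:R)%:E = z ^+ k.
Proof. by rewrite /zpow natrK. Qed.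

Lemma zpow_norm_le1 z x : `|z| <= 1 -> `|zpow z x| <= 1.
Proof.
by move=> z1; case: x => [r| |] /=; rewrite ?normr0// normrX exprn_ile1.
Qed.

Lemma extended_natD x y : extended_nat x -> extended_nat y -> extended_nat (x + y)%E.
Proof.
move=> [->|[k ->]] [->|[l ->]]; [left|left|left|right]; rewrite ?addey ?addye//.
by exists (k + l)%N; rewrite natrD EFinD.
Qed.

Lemma extended_nat_ge0 x : extended_nat x -> (0 <= x)%E.
Proof. by case=> [->|[k ->]]; rewrite ?leey// lee_fin. Qed.

Lemma extended_nat_bool (b : bool) : @extended_nat R (b%:R)%:E.
Proof. by right; exists b. Qed.

Lemma zpowD z x y : extended_nat x -> extended_nat y ->
  zpow z (x + y)%E = zpow z x * zpow z y.
Proof.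
move=> [->|[k ->]] [->|[l ->]]; rewrite /= ?mul0r ?mulr0//.
by rewrite -natrD !natrK exprD.
Qed.

Lemma measurable_truncn : measurable_fun setT (@Num.truncn R : R -> nat).
Proof.
apply: (measurability _ NGenCInfty.measurableE) => _ [_ [n ->] <-].
(* [truncn] sends negative reals to 0, so the case [n = 0] gives the whole line. *)
rewrite setTI (_ : _ @^-1` _ = if n is 0 then setT else `[n%:R, +oo[%classic).
  by case: n => // n; exact: measurable_itv.
apply/seteqP; split => r; case: n => [|n]; rewrite /= ?in_itv /= ?andbT ?leEnat ?truncn_gt_nat//.
Qed.

Lemma measurable_zpow z : measurable_fun setT (zpow z).
Proof.
have -> : zpow z = fun x => if x \is a fin_num then z ^+ Num.truncn (fine x) else 0.
  by apply/funext => -[].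
apply: measurable_fun_ifT => //.
  apply: (measurable_fun_bool true).
  by apply: (emeasurable_fin_num measurableT); exact: measurable_id.
apply: (measurableT_comp (f := fun n : nat => z ^+ n)) => //.
by apply: measurableT_comp => //; exact: measurable_truncn.
Qed.

(** Once the coefficients below [k] vanish, the series is [z ^+ k * c k] plus a tail dominated by a
    geometric series. As the limit is 0, this gives [|c k| * (1 - z) <= z], and [z] can be taken
    small. The inequality [tail] is the geometric bound multiplied through by [1 - z], a form suited
    to induction on [n]. *)
Lemma power_series_eq0 (c : nat -> R) : (forall k, `|c k| <= 1) ->
  (forall z, 0 < z < 1 -> series (fun k => z ^+ k * c k) @ \oo --> (0 : R)) ->
  forall k, c k = 0.
Proof.
move=> c1 c0 k; elim/ltn_ind: k => k IH.
have tail z : 0 < z < 1 -> forall n,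
    `|series (fun k => z ^+ k * c k) (n + k.+1)%N - z ^+ k * c k| * (1 - z)
      <= z ^+ k.+1 - z ^+ (n + k.+1).
  move=> /andP[z0 z1]; elim => [|n IHn].
    rewrite add0n subrr seriesEord /= big_ord_recr /= big1 ?add0r ?subrr ?normr0 ?mul0r//.
    by move=> i _; rewrite IH ?mulr0.
  rewrite addSn seriesS -addrA.
  set s := series _ _ - _; set e := z ^+ (n + k.+1) * _.
  have e1 : `|e| <= z ^+ (n + k.+1).
    by rewrite normrM (ger0_norm (exprn_ge0 _ (ltW z0))) ler_piMr// exprn_ge0// ltW.
  have := ler_normD e s; set S := `|s|; set E := `|e|.
  have z1' : 0 <= 1 - z by rewrite subr_ge0 ltW.
  move=> h; apply: (le_trans (ler_wpM2r z1' h)).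
  rewrite mulrDl.
  have := ler_wpM2r z1' e1; rewrite -/E.
  move: IHn; rewrite -/s -/S => IHn.
  rewrite [z ^+ (n + k.+1).+1]exprS.
  lra.
have ck z : 0 < z < 1 -> `|c k| * (1 - z) <= z.
  move=> z01; have /andP[z0 z1] := z01.
  have z1' : 0 < 1 - z by rewrite subr_gt0.
  have cv : `|series (fun k => z ^+ k * c k) (n + k.+1)%N - z ^+ k * c k| * (1 - z)
      @[n --> \oo] --> `|0 - z ^+ k * c k| * (1 - z).
    apply: cvgMl; apply: cvg_norm; apply: cvgB; last exact: cvg_cst.
    by rewrite (cvg_shiftn k.+1); exact: c0.
  have : `|0 - z ^+ k * c k| * (1 - z) <= z ^+ k.+1.
    move/cvg_lim : (cv) => <-//; apply: limr_le; first by apply/cvg_ex; eexists; exact: cv.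
    near=> n; apply: (le_trans (tail _ z01 n)).
    by rewrite gerBl exprn_ge0// ltW.
  rewrite sub0r normrN normrM (ger0_norm (exprn_ge0 _ (ltW z0))) exprSr -mulrA ler_pM2l//.
  by rewrite exprn_gt0.
apply/eqP; rewrite -normr_eq0 eq_le normr_ge0 andbT; apply/ler_addgt0Pr => e e0.
rewrite add0r.
(* [z <= 1/2] turns the bound [ck] into [|c k| <= 2 * z], and [z <= e/2] makes this at most [e]. *)
pose z := Num.min (1 / 2) (e / 2).
have z0 : 0 < z by rewrite lt_min; apply/andP; split; lra.
have z1 : z <= 1 / 2 by rewrite ge_min lexx.
have ze : z <= e / 2 by rewrite ge_min lexx orbT.
have z01 : 0 < z < 1 by rewrite z0 /=; lra.
have := ck _ z01; have := c1 k; have := normr_ge0 (c k).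
set C := `|c k|; nra.
Unshelve. all: end_near. Qed.

Lemma cdf_mass_inj (F G : nat -> R) : cdf_mass F =1 cdf_mass G -> F =1 G.
Proof.
move=> FG; elim => [|k IH]; first exact: (FG 0%N).
by have := FG k.+1; rewrite /= IH => /addIr.
Qed.

Lemma z_transform_inj (F G : nat -> R) :
  (forall k, 0 <= cdf_mass F k <= 1) -> (forall k, 0 <= cdf_mass G k <= 1) ->
  (forall z, 0 < z < 1 ->
     exists2 l, has_z_transform F z l & has_z_transform G z l) -> F =1 G.
Proof.
move=> F1 G1 FG; apply: cdf_mass_inj => k; apply/eqP; rewrite -subr_eq0; apply/eqP.
apply: (@power_series_eq0 (fun k => cdf_mass F k - cdf_mass G k)) => {k}[k|z z01].
  have /andP[? ?] := F1 k; have /andP[? ?] := G1 k.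
  by rewrite ler_norml; apply/andP; split; lra.
have [l Fl Gl] := FG z z01.
rewrite -(subrr l).
rewrite (_ : series _ = series (fun k => z ^+ k * cdf_mass F k) -
                        series (fun k => z ^+ k * cdf_mass G k)).
  exact: cvgB.
apply/funext => n; rewrite fctE !seriesEnat /= -sumrB; apply: eq_bigr => i _.
by rewrite mulrBr.
Qed.

End z_transforms.

(** * The z-transform of a random count *)

Section z_transform_probability.
Context d (Omega : measurableType d) (R : realType) (P : probability Omega R).
Variables (X : Omega -> \bar R) (F : nat -> R).
Hypothesis mX : measurable_fun setT X.
Hypothesis Xnat : forall w, extended_nat (X w).
Hypothesis FX : forall k, P [set w | (X w <= (k%:R : R)%:E)%E] = (F k)%:E.

Let mXeq k : measurable [set w | X w = (k%:R : R)%:E].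
Proof. by have := mX measurableT (emeasurable_set1 (k%:R : R)%:E); rewrite setTI. Qed.

Let mXle k : measurable [set w | (X w <= (k%:R : R)%:E)%E].
Proof. by rewrite -[X in measurable X]setTI; exact: emeasurable_fun_infty_c. Qed.

Lemma cdf_massE k : cdf_mass F k = fine (P [set w | X w = (k%:R : R)%:E]).
Proof.
case: k => [|k] /=.
  rewrite -[F 0]/(fine (F 0)%:E) -FX; congr (fine (P _)); apply/seteqP; split => w /=.
    by move=> X0; apply/eqP; rewrite eq_le X0 extended_nat_ge0.
  by move->.
rewrite -[F k.+1]/(fine (F k.+1)%:E) -[F k]/(fine (F k)%:E) -!FX -fineB ?fin_num_measure//.
rewrite -[X in (_ - P X)%E](@setIidr _ [set w | (X w <= (k.+1%:R : R)%:E)%E]); last first.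
  by move=> w /= /le_trans; apply; rewrite lee_fin ler_nat.
rewrite -[X in fine X = _]measureD//; last first.
  by apply: (le_lt_trans (probability_le1 P (mXle _))); rewrite ltry.
congr (fine (P _)); apply/seteqP; split => w /=.
  move=> [+ /negP]; rewrite -ltNge; case: (Xnat w) => [->//|[j ->]].
  rewrite lee_fin lte_fin ler_nat ltr_nat => jk kj; congr (_%:R%:E); apply/eqP.
  by rewrite eqn_leq jk.
by move->; split => //; apply/negP; rewrite -ltNge lte_fin ltr_nat.
Qed.

Lemma cdf_mass_itv k : 0 <= cdf_mass F k <= 1.
Proof.
rewrite cdf_massE fine_ge0//= -lee_fin fineK ?fin_num_measure//.
exact: (probability_le1 P (mXeq k)).
Qed.

(** [S n] is [zpow z X] where [X < n] and 0 elsewhere, and its mean is a partial sum of the series.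
    At each point it is eventually constant, also where [X] is +oo, and it is bounded by 1; so
    dominated convergence covers the boundary [|z| = 1] as well. *)
Lemma has_z_transform_zpow z : `|z| <= 1 ->
  has_z_transform F z (\int[P]_w zpow z (X w)).
Proof.
move=> z1; rewrite /has_z_transform.
pose S n w := \sum_(k < n) z ^+ k * \1_[set w | X w = (k%:R : R)%:E] w : R.
have mS n : measurable_fun setT (S n).
  apply: measurable_sum => k; apply: measurable_funM => //.
have SE n w : S n w = if [exists k : 'I_n, X w == (k%:R : R)%:E] then zpow z (X w) else 0.
  case: ifPn => [/existsP[k /eqP Xk]|/existsPn h].
    rewrite /S (bigD1 k)//= Xk zpow_nat indicE mem_set//= mulr1 big1 ?addr0// => j jk.
    rewrite indicE memNset ?mulr0//= Xk => -[] /eqP; rewrite eqr_nat => /eqP kj.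
    by move/eqP: jk; apply; apply/val_inj.
  rewrite /S big1// => k _; rewrite indicE memNset ?mulr0//=.
  by apply/eqP; exact: h.
have S1 n w : `|S n w| <= 1.
  by rewrite SE; case: ifP => _; rewrite ?normr0//; exact: zpow_norm_le1.
have -> : series (fun k => z ^+ k * cdf_mass F k) = fun n => \int[P]_w S n w.
  apply/funext => n; rewrite seriesEord /=.
  elim: n => [|n IHn].
    rewrite big_ord0 /S; under eq_Rintegral do rewrite big_ord0.
    by rewrite /Rintegral integral0.
  rewrite big_ord_recr /= IHn /S.
  under [RHS]eq_Rintegral do rewrite big_ord_recr /=.
  have ii := integrable_indic_prob P (mXeq n).
  rewrite RintegralD//.
  - by rewrite RintegralZl// Rintegral_indic// cdf_massE.
  - exact: (@bounded_integrable _ _ _ _ _ 1 (mS n)).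
  - exact: (integrableZl measurableT (z ^+ n) ii).
apply: (@bounded_cvg_Rintegral _ _ _ _ _ _ 1) => // w.
case: (Xnat w) => [Xoo|[k Xk]].
  rewrite Xoo /=; apply: cvg_near_cst; near=> n; rewrite SE Xoo /=.
  by case: existsP.
apply: cvg_near_cst; near=> n; rewrite SE ifT//; apply/existsP.
have kn : (k < n)%N by near: n; exact: nbhs_infty_gt.
by exists (Ordinal kn); rewrite Xk.
Unshelve. all: end_near. Qed.

End z_transform_probability.

(** * Pointwise limits of step functions *)

Section baire.
Import HBSimple.
Context (R : realType).
Implicit Types (f g q : R -> R).

(* Step functions on the cells cut out by the points of [l]; in this form sums
   and products need no common refinement of two subdivisions. *)
Definition finite_cuts q := exists l : seq R,
  forall x y, (forall a, a \in l -> (x <= a) = (y <= a)) -> q x = q y.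

(** Induction on a derivation proves for all measurable functions what holds for step functions and
    survives pointwise limits. The limits are taken at every point, as nothing is known beforehand
    on how the birth times charge Lebesgue null sets. *)
Inductive baire : (R -> R) -> Prop :=
| baire_cuts q : finite_cuts q -> measurable_fun setT q -> baire q
| baire_lim (f_ : nat -> R -> R) f : (forall n, baire (f_ n)) ->
    (forall x, f_ ^~ x @ \oo --> f x) -> baire f.

Lemma finite_cuts2 (op : R -> R -> R) f g : finite_cuts f -> finite_cuts g ->
  finite_cuts (fun x => op (f x) (g x)).
Proof.
move=> [l lf] [l' lg]; exists (l ++ l') => x y xy.
by rewrite (lf x y) ?(lg x y)// => a al; apply: xy; rewrite mem_cat al ?orbT.
Qed.

(** Double induction: for [f] a step function, the functions [g] satisfying the claim are closed
    under limits; then, for [g] arbitrary, so are the functions [f]. *)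
Lemma baire2 (op : R -> R -> R) :
  (forall (u v : nat -> R) a b, u @ \oo --> a -> v @ \oo --> b ->
     op (u n) (v n) @[n --> \oo] --> op a b) ->
  (forall f g : R -> R, measurable_fun setT f -> measurable_fun setT g ->
     measurable_fun setT (fun x => op (f x) (g x))) ->
  forall f g, baire f -> baire g -> baire (fun x => op (f x) (g x)).
Proof.
move=> opc opm f g bf; elim: bf g => {f} [f cf mf|f_ f _ IH ff] g bg.
  elim: bg => {g} [g cg mg|g_ g _ IH gg].
    by apply: baire_cuts; [exact: finite_cuts2|exact: opm].
  apply: (@baire_lim (fun n x => op (f x) (g_ n x))) => // x.
  by apply: opc; [exact: cvg_cst|exact: gg].
apply: (@baire_lim (fun n x => op (f_ n x) (g x))) => [n|x]; first exact: IH.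
by apply: opc; [exact: ff|exact: cvg_cst].
Qed.

Lemma baire_cst (r : R) : baire (fun=> r).
Proof. by apply: baire_cuts => //; exists [::]. Qed.

Lemma baireD f g : baire f -> baire g -> baire (fun x => f x + g x).
Proof.
apply: (baire2 (op := +%R)) => [u v a b ua vb|f' g']; first exact: cvgD.
exact: measurable_funD.
Qed.

Lemma baireM f g : baire f -> baire g -> baire (fun x => f x * g x).
Proof.
apply: (baire2 (op := *%R)) => [u v a b ua vb|f' g']; first exact: cvgM.
exact: measurable_funM.
Qed.

(** The sets with a Baire indicator form a sigma-algebra containing the rays []a, +oo[], whose
    indicator has the single cut [a]. Sums and products handle finite unions, through
    [1_A + 1_B - 1_A * 1_B]; countable unions are limits of these. *)
Lemma baire_indic (A : set R) : measurable A -> baire (\1_A).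
Proof.
have ext f g : f =1 g -> baire f -> baire g by move=> /funext ->.
rewrite [X in X _](@RGenOInfty.measurableE R) => mA.
suff sG : <<s @RGenOInfty.G R>> `<=` [set A | baire (\1_A)] by exact: sG.
apply: smallest_sub; last first.
  move=> _ [a ->]; apply: baire_cuts; last by apply: measurable_indic; exact: measurable_itv.
  exists [:: a] => x y /(_ a (mem_head _ _)); rewrite !indicE !mem_setE !in_itv /= !andbT.
  by case: (leP x a); case: (leP y a).
split.
- by apply: ext (baire_cst 0) => x; rewrite indic0.
- move=> B bB; apply: ext (baireD (baire_cst 1) (baireM (baire_cst (-1)) bB)) => x.
  rewrite !indicE in_setD in_setT /=; case: (x \in B); rewrite /=; lra.
- move=> F bF.
  have bU n : baire (\1_(\bigcup_(i in `I_n) F i)).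
    elim: n => [|n IHn].
      by apply: ext (baire_cst 0) => x; rewrite II0 bigcup_set0 indic0.
    have := baireD (baireD IHn (bF n)) (baireM (baire_cst (-1)) (baireM IHn (bF n))).
    apply: ext => x; rewrite IIS bigcup_setU bigcup_set1 !indicE in_setU.
    by case: (x \in _); case: (x \in _); rewrite /=; lra.
  apply: (baire_lim bU) => x.
  have [xF|xF] := pselect ((\bigcup_i F i) x).
    have [k _ Fk] := xF.
    apply: cvg_near_cst; near=> n.
    rewrite !indicE !mem_set//; exists k => //.
    by near: n; exact: nbhs_infty_gt.
  apply: cvg_near_cst; near=> n.
  rewrite !indicE !memNset//; apply: contra_not xF => -[k _ Fk].
  by exists k.
Unshelve. all: end_near. Qed.

Lemma baire_sum (I : Type) (s : seq I) (f_ : I -> R -> R) :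
  (forall i, baire (f_ i)) -> baire (fun x => \sum_(i <- s) f_ i x).
Proof.
have ext f g : f =1 g -> baire f -> baire g by move=> /funext ->.
move=> bf; elim: s => [|i s IH].
  by apply: ext (baire_cst 0) => x; rewrite big_nil.
by apply: ext (baireD (bf i) IH) => x; rewrite big_cons.
Qed.

Lemma measurable_baire f : measurable_fun setT f -> baire f.
Proof.
have ext f' g : f' =1 g -> baire f' -> baire g by move=> /funext ->.
move=> mf.
have [g gf] := approximation_sfun measurableT
  (f := EFin \o f) (measurableT_comp (@EFin_measurable R setT) mf).
pose f_ (n : nat) (x : R) : R := g n x.
suff bf_ n : baire (f_ n) by apply: (baire_lim bf_) => x; exact: (fine_cvg (gf x I)).
apply: ext; first by move=> x; exact/esym/fimfunEord.
apply: baire_sum => i; apply: baireM; first exact: baire_cst.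
by apply: baire_indic; exact: measurable_sfunP.
Qed.

End baire.

(** * The generating functional of the births *)

Section poisson_series.
Context (R : realType).
Implicit Types (c r : R).

Lemma prod_norm_le1 (I : Type) (s : seq I) (F : I -> R) :
  (forall i, `|F i| <= 1) -> `|\prod_(i <- s) F i| <= 1.
Proof.
move=> F1; elim: s => [|i s IH]; first by rewrite big_nil normr1.
by rewrite big_cons normrM mulr_ile1.
Qed.

Lemma cvg_prodr (I : Type) (s : seq I) (F : I -> nat -> R) (l : I -> R) :
  (forall i, F i @ \oo --> l i) ->
  \prod_(i <- s) F i n @[n --> \oo] --> \prod_(i <- s) l i.
Proof.
move=> Fl; elim: s => [|i s IH].
  by rewrite big_nil; under eq_fun do rewrite big_nil; exact: cvg_cst.
rewrite big_cons; under eq_fun do rewrite big_cons.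
exact: cvgM.
Qed.

Lemma poisson_massE c r k :
  c ^+ k * poisson_mass r k = expR (- r) * exp_coeff (c * r) k.
Proof. by rewrite /poisson_mass /exp_coeff /= exprMn; ring. Qed.

Lemma poisson_mass_ge0 r k : 0 <= r -> 0 <= poisson_mass r k.
Proof. by move=> r0; rewrite /poisson_mass !mulr_ge0 ?expR_ge0 ?exprn_ge0 ?invr_ge0. Qed.

Lemma measurable_poisson_mass k : measurable_fun setT (fun r => poisson_mass r k).
Proof.
apply: measurable_funM => //; apply: measurable_funM; last exact: exprn_measurable.
by apply: measurableT_comp; [exact: measurable_expR|exact: oppr_measurable].
Qed.

Lemma cvg_poisson_pgf c r :
  (\sum_(k < n) c ^+ k * poisson_mass r k) @[n --> \oo] --> expR (- (r * (1 - c))).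
Proof.
have -> : - (r * (1 - c)) = - r + c * r by ring.
rewrite expRD.
under eq_fun => n do under eq_bigr do rewrite poisson_massE.
under eq_fun => n do rewrite -mulr_sumr.
apply: cvgMr.
have cv : series (exp_coeff (c * r)) @ \oo --> expR (c * r) := is_cvg_series_exp_coeff _.
by rewrite seriesEord in cv.
Qed.

(** The sum is dominated by Poisson masses, whose total is the value 1 of the generating function at
    [c = 1]. Being uniform in [n], the bound serves as dominating constant in
    [grid_expectation_cvg]. *)
Lemma poisson_pgf_le1 c r n : 0 <= r -> `|c| <= 1 ->
  `|\sum_(k < n) c ^+ k * poisson_mass r k| <= 1.
Proof.
move=> r0 c1; apply: (le_trans (ler_norm_sum _ _ _)).
have h1 : \sum_(k < n) poisson_mass r k <= 1.
  have cv := @cvg_poisson_pgf 1 r.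
  rewrite subrr mulr0 oppr0 expR0 in cv.
  rewrite -(cvg_lim _ cv)//.
  have -> : \sum_(k < n) poisson_mass r k = \sum_(k < n) 1 ^+ k * poisson_mass r k.
    by apply: eq_bigr => k _; rewrite expr1n mul1r.
  apply: (@nondecreasing_cvgn_le _ (fun n => \sum_(k < n) 1 ^+ k * poisson_mass r k)).
    apply/nondecreasing_seqP => k; rewrite big_ord_recr /= lerDl.
    by rewrite expr1n mul1r poisson_mass_ge0.
  by apply/cvg_ex; eexists; exact: cv.
apply: le_trans h1; apply: ler_sum => k _.
rewrite normrM normrX (ger0_norm (poisson_mass_ge0 _ r0)) ler_piMl ?poisson_mass_ge0//.
by rewrite exprn_ile1.
Qed.

Lemma poisson_mass_le1 r k : 0 <= r -> poisson_mass r k <= 1.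
Proof.
move=> r0; have := @poisson_pgf_le1 1 r k.+1 r0; rewrite normr1 lexx => /(_ isT).
apply: le_trans; apply: le_trans (ler_norm _).
rewrite big_ord_recr /= expr1n mul1r lerDr sumr_ge0// => i _.
by rewrite expr1n mul1r poisson_mass_ge0.
Qed.

End poisson_series.

(** * Integrals against the rate *)

Section rate.
Context (R : realType) (h : R -> R).
Hypothesis h_ge0 : forall s, 0 <= s -> 0 <= h s.
Hypothesis h_loc : locally_integrable_half_line h.

Lemma integrable_rate (u b : R) (r : R -> R) : 0 <= u ->
  measurable_fun `[0, u]%classic r -> (forall x, 0 <= x <= u -> `|r x| <= b) ->
  (@lebesgue_measure R).-integrable `[0, u]%classic (EFin \o (fun x => h x * r x)).
Proof.
move=> u0 mr rb.
have hi := h_loc u0.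
have mh : measurable_fun `[0, u]%classic h by apply/measurable_EFinP; exact: measurable_int hi.
have hb : (@lebesgue_measure R).-integrable `[0, u]%classic (fun x => b%:E * (EFin \o h) x)%E.
  by apply: integrableZl => //; exact: measurable_itv.
apply: (le_integrable _ _ _ hb); first exact: measurable_itv.
  by apply/measurable_EFinP; exact: measurable_funM.
move=> x /= xu; rewrite lee_fin !normrM mulrC ler_wpM2r//.
by rewrite (le_trans (rb _ _) (ler_norm _))//; move: xu; rewrite in_itv.
Qed.

(** Additivity over the cells. The value of [q] at the left end of a cell is not given by [c j], but
    a single point is Lebesgue null. *)
Lemma rate_integral_cells (m : nat) (s c : nat -> R) (q : R -> R) :
  s 0%N = 0 -> {homo s : i j / (i <= j)%N >-> i <= j} ->
  measurable_fun setT q -> (forall x, `|q x| <= 1) ->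
  (forall j x, s j < x <= s j.+1 -> q x = c j) ->
  \int[lebesgue_measure]_(x in `[0, s m]) (h x * (1 - q x)) =
  \sum_(j < m) (\int[lebesgue_measure]_(x in `[s j, s j.+1]) h x) * (1 - c j).
Proof.
move=> s0 s_homo mq q1 qc.
have sge0 j : 0 <= s j by rewrite -s0; exact: s_homo.
have ih (u : R) : 0 <= u ->
    (@lebesgue_measure R).-integrable `[0, u]%classic (EFin \o (fun x => h x * (1 - q x))).
  move=> u0; apply: (@integrable_rate _ 2) => //.
    by apply: measurable_funTS; exact: measurable_funB.
  by move=> x _; rewrite (le_trans (ler_normB _ _))// normr1 (natrD _ 1 1) lerD.
elim: m => [|m IH].
  by rewrite s0 set_itv1 Rintegral_set1 big_ord0.
rewrite big_ord_recr /= -IH.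
have := @Rintegral_itvB _ (fun x => h x * (1 - q x)) (BLeft 0) (BRight (s m.+1)) (s m)
  (ih _ (sge0 _)).
rewrite !bnd_simp => /(_ (sge0 _) (s_homo _ _ (leqnSn _)))/eqP.
rewrite subr_eq addrC => /eqP ->; congr (_ + _).
have sub : `]s m, s m.+1] `<=` `[0, s m.+1].
  by move=> x /=; rewrite !in_itv /= => /andP[sx ->]; rewrite (le_trans (sge0 m) (ltW sx)).
transitivity (\int[lebesgue_measure]_(x in `]s m, s m.+1]) (h x * (1 - c m))).
  by apply: eq_Rintegral => x; rewrite inE /= in_itv /= => xs; rewrite (qc m).
have hs : (@lebesgue_measure R).-integrable `]s m, s m.+1] (EFin \o h).
  by apply: (integrableS _ _ _ (h_loc (sge0 m.+1))) => //; exact: measurable_itv.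
by rewrite RintegralZr// Rintegral_itv_obnd_cbnd.
Qed.

Lemma rate_integral_cvg (u b : R) (r_ : nat -> R -> R) (r : R -> R) : 0 <= u ->
  (forall n, measurable_fun setT (r_ n)) -> (forall n x, `|r_ n x| <= b) ->
  (forall x, r_ ^~ x @ \oo --> r x) ->
  \int[lebesgue_measure]_(x in `[0, u]) (h x * r_ n x) @[n --> \oo] -->
  \int[lebesgue_measure]_(x in `[0, u]) (h x * r x).
Proof.
move=> u0 mr_ rb rr.
have mr : measurable_fun setT r by apply: measurable_fun_cvg => // x _; exact: rr.
have rb' x : `|r x| <= b by apply: (cvg_norm_le (rr x)) => n; exact: rb.
have hi := h_loc u0.
have mh : measurable_fun `[0, u]%classic h by apply/measurable_EFinP; exact: measurable_int hi.
have hb : (@lebesgue_measure R).-integrable `[0, u]%classic (fun x => b%:E * (EFin \o h) x)%E.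
  by apply: integrableZl => //; exact: measurable_itv.
have mhr f : measurable_fun setT f -> measurable_fun `[0, u]%classic (fun x => (h x * f x)%:E).
  move=> mf; apply/measurable_EFinP; apply: measurable_funM => //; exact: measurable_funTS.
have [|||||_ _ cv] := @dominated_convergence _ _ _ (@lebesgue_measure R) `[0, u]%classic
  (measurable_itv _) (fun n x => (h x * r_ n x)%:E) (fun x => (h x * r x)%:E)
  (fun x => (b%:E * (EFin \o h) x)%E).
- by move=> n; exact: mhr.
- exact: mhr.
- apply: aeW => x _; apply: cvg_EFin; first exact: nearW.
  by apply: cvgMr; exact: rr.
- exact: hb.
- apply: aeW => x n /=; rewrite in_itv /= => /andP[x0 _].
  by rewrite lee_fin normrM (ger0_norm (h_ge0 x0)) mulrC ler_wpM2r// h_ge0.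
apply: fine_cvg; rewrite fineK; first exact: cv.
apply: integrable_fin_num; first exact: measurable_itv.
by apply: (@integrable_rate _ b) => //; exact: measurable_funTS.
Qed.

End rate.

(** * Products over the births of one individual *)

Section births.
Context d (Omega : measurableType d) (R : realType) (P : probability Omega R).
Variables (h : R -> R) (B : Omega -> R) (T : nat -> Omega -> \bar R).
Hypothesis h_ge0 : forall s, 0 <= s -> 0 <= h s.
Hypothesis h_loc : locally_integrable_half_line h.
Hypothesis mB : measurable_fun setT B.
Hypothesis mT : forall i, measurable_fun setT (T i).
Hypothesis B_ge0 : forall w, 0 <= B w.
Hypothesis T_homo : forall w, {homo T ^~ w : i j / (i <= j)%N >-> (i <= j)%E}.
Hypothesis poissonBT : conditionally_poisson P h B T.

Lemma measurable_le_birth i r : measurable [set w | (T i w <= r%:E)%E].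
Proof. by rewrite -[X in measurable X]setTI; exact: emeasurable_fun_infty_c. Qed.

Lemma measurable_fun_le_birth i r : measurable_fun setT (fun w => (T i w <= r%:E)%E).
Proof. exact: measurable_fun_lee. Qed.

Lemma measurable_children_count r : measurable_fun setT (children_count T r).
Proof.
apply: ge0_emeasurable_sum => // i _; apply/measurable_EFinP.
have -> : (fun w => (T i w <= r%:E)%E%:R : R) =
          fun w => if (T i w <= r%:E)%E then 1 else 0.
  by apply/funext => w; case: ifP.
by apply: measurable_fun_ifT => //; exact: measurable_fun_le_birth.
Qed.

Lemma children_countE (N : nat) w r : (r%:E < T N w)%E ->
  children_count T r w = ((\sum_(i < N) (T i w <= r%:E)%E)%N%:R : R)%:E.
Proof.
move=> rT; rewrite /children_count (nneseries_split 0 N)//=.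
rewrite add0n eseries0 ?adde0 => [|i Ni _]; last first.
  rewrite leNgt (lt_le_trans rT)//; exact: T_homo.
by rewrite big_mkord natr_sum sumEFin.
Qed.

(** * Numbers of births in the cells of a grid *)

Section grid.
Variables (m : nat) (s : nat -> R).
Hypothesis s0 : s 0%N = 0.
Hypothesis s_homo : {homo s : i j / (i <= j)%N >-> i <= j}.

Definition cell_mass (j : nat) : R :=
  \int[lebesgue_measure]_(x in `[s j, s j.+1]) h x.

Lemma cell_mass_ge0 j : 0 <= cell_mass j.
Proof.
apply: Rintegral_ge0 => x /=; rewrite in_itv /= => /andP[sx _].
by apply: h_ge0; apply: le_trans sx; rewrite -s0; exact: s_homo.
Qed.

Definition grid_event (n : 'I_m -> nat) : set Omega :=
  [set w | children_count T 0 w = 0%E /\ forall j : 'I_m,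
     children_count T (s j.+1) w
       = (children_count T (s j) w + ((n j)%:R : R)%:E)%E].

Lemma measurable_grid_event n : measurable (grid_event n).
Proof.
have -> : grid_event n = [set w | children_count T 0 w = 0%E] `&`
    \bigcap_(j in [set: 'I_m]) [set w | children_count T (s j.+1) w
       = (children_count T (s j) w + ((n j)%:R : R)%:E)%E].
  apply/seteqP; split => w [w0 wj]; split => // j; first by move=> _; exact: wj.
  exact: (wj j I).
have meq (f g : Omega -> \bar R) : measurable_fun setT f -> measurable_fun setT g ->
    measurable [set w | f w = g w].
  move=> mf mg; rewrite (_ : mkset _ = (fun w => f w == g w) @^-1` [set true]).
    by rewrite -[X in measurable X]setTI; exact: measurable_fun_eqe.
  by apply/seteqP; split => w /= /eqP.
apply: measurableI; first by apply: meq => //; exact: measurable_children_count.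
apply: fin_bigcap_measurable => // j _; apply: meq.
  exact: measurable_children_count.
by apply: emeasurable_funD => //; exact: measurable_children_count.
Qed.

Lemma measurable_cell_poisson j k :
  measurable_fun setT (fun w => poisson_mass (B w * cell_mass j) k).
Proof.
apply: (measurableT_comp (@measurable_poisson_mass R k)).
exact: measurable_funM.
Qed.

Lemma grid_event_prob n :
  fine (P (grid_event n)) =
  \int[P]_w \prod_(j < m) poisson_mass (B w * cell_mass j) (n j).
Proof.
pose n' j := if insub j is Some i then n i else 0%N.
have n'E (j : 'I_m) : n' j = n j.
  by rewrite /n' insubT//= => jm; congr n; exact/val_inj.
rewrite /Rintegral; congr fine.
under eq_integral do under eq_bigr do rewrite -n'E.
have := @poissonBT setT m s n' measurableT s0 s_homo.
rewrite preimage_setT setTI => <-; congr (P _).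
apply/seteqP; split => w [w0 wj]; split => // j.
  by move=> jm; rewrite (wj (Ordinal jm)) -n'E.
by rewrite wj// n'E.
Qed.

Variable c : nat -> R.
Hypothesis c1 : forall j, `|c j| <= 1.

(** Counting among the first [N] births keeps the number at most [N], so that count vectors range
    over the finite type of functions from ['I_m] to ['I_N.+1]. For the cells below [m] it is the
    true count as soon as birth number [N] comes after [s m]. *)
Definition cell_count (N j : nat) (w : Omega) : nat :=
  \sum_(i < N) (((s j)%:E < T i w) && (T i w <= (s j.+1)%:E))%E.

Lemma cell_count_le N j w : (cell_count N j w <= N)%N.
Proof.
rewrite -[leqRHS]card_ord -sum1_card; apply: leq_sum => i _.
by case: (_ && _).
Qed.

Lemma grid_eventE N w (n : 'I_m -> nat) : ((s m)%:E < T N w)%E ->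
  children_count T 0 w = 0%E ->
  grid_event n w <-> forall j : 'I_m, n j = cell_count N j w.
Proof.
move=> sT w0.
have cE j : (j <= m)%N -> children_count T (s j) w =
    ((\sum_(i < N) (T i w <= (s j)%:E)%E)%N%:R : R)%:E.
  move=> jm; apply: children_countE; apply: le_lt_trans sT.
  by rewrite lee_fin; exact: s_homo.
have step j : (\sum_(i < N) (T i w <= (s j.+1)%:E)%E)%N =
    (\sum_(i < N) (T i w <= (s j)%:E)%E + cell_count N j w)%N.
  rewrite /cell_count -big_split /=; apply: eq_bigr => i _.
  rewrite ltNge; have [Ti|//] := boolP (T i w <= (s j)%:E)%E.
  by rewrite (le_trans Ti)// lee_fin; exact: s_homo.
have iff j (k : nat) : (j < m)%N ->
   children_count T (s j.+1) w = (children_count T (s j) w + (k%:R : R)%:E)%E <->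
   k = cell_count N j w.
  move=> jm; rewrite !cE ?(ltnW jm)// step natrD -EFinD; split => [[]/addrI/eqP|->//].
  by rewrite eqr_nat => /eqP.
split => [[_ e] j|e]; first by apply/iff => //; exact: e.
by split => // j; apply/iff.
Qed.

(** Exactly one event of the sum occurs at [w], the one whose vector is formed by the cell
    counts. *)
Lemma grid_pathwise N w : ((s m)%:E < T N w)%E -> children_count T 0 w = 0%E ->
  \sum_(n : {ffun 'I_m -> 'I_N.+1}) (\prod_(j < m) c j ^+ n j) * \1_(grid_event (fun j => n j)) w
  = \prod_(j < m) c j ^+ cell_count N j w.
Proof.
move=> sT w0; pose n0 : {ffun 'I_m -> 'I_N.+1} := [ffun j : 'I_m => inord (cell_count N j w)].
have n0E (j : 'I_m) : n0 j = cell_count N j w :> nat.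
  by rewrite ffunE inordK// ltnS cell_count_le.
rewrite (bigD1 n0)//= indicE mem_set ?mulr1; last exact/(grid_eventE _ sT w0).
rewrite [X in _ + X]big1 ?addr0 => [|n nn0].
  by apply: eq_bigr => j _; rewrite n0E.
rewrite indicE memNset ?mulr0// => /(grid_eventE _ sT w0) nE.
move/eqP: nn0; apply; apply/ffunP => j; apply/val_inj.
by rewrite /= [RHS]n0E; exact: nE.
Qed.

(** The count at age 0 vanishes, so all counts along the grid are finite and can be cancelled. *)
Lemma grid_event_inj (n n' : 'I_m -> nat) w : grid_event n w -> grid_event n' w -> n =1 n'.
Proof.
move=> [w0 nw] [_ n'w] j.
have fin k : (k <= m)%N -> children_count T (s k) w \is a fin_num.
  elim: k => [_|k IH km]; first by rewrite s0 w0.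
  by rewrite (nw (Ordinal km)) fin_numD IH//= ltnW.
have := nw j; rewrite n'w -(fineK (fin j (ltnW (ltn_ord j)))) -!EFinD => -[/addrI/eqP].
by rewrite eqr_nat => /eqP.
Qed.

(** Events of different vectors are disjoint, so at most one term survives. The bound holds at every
    [w], also where more than [N] births occur. *)
Lemma grid_sum_norm_le1 N w :
  `|\sum_(n : {ffun 'I_m -> 'I_N.+1})
      (\prod_(j < m) c j ^+ n j) * \1_(grid_event (fun j => n j)) w| <= 1.
Proof.
have cn1 (n : {ffun 'I_m -> 'I_N.+1}) : `|\prod_(j < m) c j ^+ n j| <= 1.
  by apply: prod_norm_le1 => j; rewrite normrX exprn_ile1.
have [/existsP[n /asboolP nw]|/existsPn nw] :=
    boolP [exists n : {ffun 'I_m -> 'I_N.+1}, `[< grid_event (fun j => n j) w >]].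
  rewrite (bigD1 n)//= indicE mem_set// mulr1 [X in _ + X]big1 ?addr0// => n' n'n.
  rewrite indicE memNset ?mulr0// => n'w; move/eqP: n'n; apply.
  by apply/ffunP => j; apply/val_inj; exact: (grid_event_inj n'w nw).
rewrite big1 ?normr0// => n _; rewrite indicE memNset ?mulr0// => /asboolP.
exact/negP/nw.
Qed.

(** Expanding the product of sums over all choices of one count per cell gives a term for each
    vector [n]; the mean of its Poisson factors is the probability of the corresponding grid
    event. *)
Lemma grid_expectation N :
  \int[P]_w (\sum_(n : {ffun 'I_m -> 'I_N.+1})
      (\prod_(j < m) c j ^+ n j) * \1_(grid_event (fun j => n j)) w) =
  \int[P]_w (\prod_(j < m)
      \sum_(k < N.+1) c j ^+ k * poisson_mass (B w * cell_mass j) k).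
Proof.
under [RHS]eq_Rintegral do rewrite bigA_distr_bigA /=.
have Bm w j : 0 <= B w * cell_mass j by rewrite mulr_ge0 ?cell_mass_ge0.
have ii := @integrable_indic_prob _ _ _ P.
have ip (n : {ffun 'I_m -> 'I_N.+1}) : P.-integrable setT
    (EFin \o (fun w => \prod_(j < m) poisson_mass (B w * cell_mass j) (n j))).
  apply: (@bounded_integrable _ _ _ _ _ 1).
    by apply: measurable_prod => j _; exact: measurable_cell_poisson.
  move=> w; apply: prod_norm_le1 => j.
  by rewrite ger0_norm ?poisson_mass_ge0 ?poisson_mass_le1.
rewrite Rintegral_sum => [|n]; last first.
  exact: (integrableZl measurableT _ (ii _ (measurable_grid_event _))).
under [RHS]eq_Rintegral do under eq_bigr do rewrite big_split /=.
rewrite Rintegral_sum => [|n]; last first.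
  exact: (integrableZl measurableT _ (ip n)).
apply: eq_bigr => n _.
rewrite RintegralZl//; last exact/ii/measurable_grid_event.
rewrite RintegralZl// Rintegral_indic; last exact: measurable_grid_event.
by rewrite grid_event_prob.
Qed.

Lemma grid_expectation_cvg :
  \int[P]_w (\sum_(n : {ffun 'I_m -> 'I_N.+1})
      (\prod_(j < m) c j ^+ n j) * \1_(grid_event (fun j => n j)) w) @[N --> \oo] -->
  \int[P]_w expR (- (B w * \sum_(j < m) cell_mass j * (1 - c j))).
Proof.
under eq_fun do rewrite grid_expectation.
have Bm w j : 0 <= B w * cell_mass j by rewrite mulr_ge0 ?cell_mass_ge0.
apply: (@bounded_cvg_Rintegral _ _ _ P _ _ 1) => [N|N w|w].
- apply: measurable_prod => j _; apply: measurable_sum => k.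
  by apply: measurable_funM => //; exact: measurable_cell_poisson.
- by apply: prod_norm_le1 => j; exact: poisson_pgf_le1.
- rewrite mulr_sumr -sumrN expR_sum; apply: cvg_prodr => j.
  rewrite mulrA; have := @cvg_poisson_pgf R (c j) (B w * cell_mass j).
  by rewrite -cvg_shiftS.
Qed.

End grid.

(** On the grid without cells the event says only that no birth occurs at age 0, and its probability
    is the mean of an empty product. *)
Lemma children_count0_null : P [set w | children_count T 0 w != 0%E] = 0%E.
Proof.
pose s := fun _ : nat => 0 : R.
have := @grid_event_prob 0 s erefl (fun _ _ _ => lexx _) (fun _ => 0%N).
under eq_Rintegral do rewrite big_ord0.
have m0 := @measurable_grid_event 0 s (fun _ => 0%N).
rewrite Rintegral_cst_prob => p1.
have -> : [set w | children_count T 0 w != 0%E] = ~` grid_event s (fun _ : 'I_0 => 0%N).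
  apply/seteqP; split => w /=; first by move=> /eqP w0 [].
  by move=> nw; apply/eqP => w0; apply: nw; split => // -[].
rewrite probability_setC// -(@fineK _ (P (grid_event s _)))  ?fin_num_measure//.
by rewrite [X in (_ - X%:E)%E]p1 subee.
Qed.

(* The infinite product over the births up to age [u] is approached by its first
   [M] factors. The error [2 * birth_tail u M] does not depend on [q], so that a
   bound on the finite products passes to pointwise limits of functions [q]. *)
Definition birth_prod (u : R) (q : R -> R) (M : nat) (w : Omega) : R :=
  \prod_(i < M) (if (T i w <= u%:E)%E then q (fine (T i w)) else 1).

Definition birth_tail (u : R) (M : nat) : R := fine (P [set w | (T M w <= u%:E)%E]).

Lemma children_count_ge (u : R) M w : (T M w <= u%:E)%E ->
  ((M.+1%:R : R)%:E <= children_count T u w)%E.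
Proof.
move=> TM.
have := @nneseries_lim_ge R (fun i => ((T i w <= u%:E)%E%:R : R)%:E) predT 0 M.+1
  (fun _ _ _ => ltac:(by rewrite lee_fin)).
apply: le_trans; rewrite big_mkord sumEFin lee_fin.
rewrite (eq_bigr (fun=> 1)) ?sumr_const ?card_ord// => i _.
by rewrite (le_trans _ TM)//; apply: T_homo; rewrite -ltnS.
Qed.

Lemma birth_gt0 i w : children_count T 0 w = 0%E -> (0 < T i w)%E.
Proof.
move=> w0; rewrite ltNge; apply/negP => /children_count_ge.
by rewrite w0 lee_fin lern0.
Qed.

(** On the single cell from 0 to [u], with weight 1, [S N] indicates that there are at most [N]
    births and none at age 0; its mean tends to 1. Births being numbered from 0, [T N <= u] means at
    least [N.+1] births, which excludes that event. *)
Lemma birth_tail_cvg0 (u : R) : 0 <= u -> birth_tail u @ \oo --> (0 : R).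
Proof.
move=> u0; pose s j := if j is 0%N then 0 else u.
have s_homo : {homo s : i j / (i <= j)%N >-> i <= j} by case=> [|i] [|j].
have cv := @grid_expectation_cvg 1 s erefl s_homo (fun=> 1) (fun=> ltac:(by rewrite normr1)).
pose S N w : R := \sum_(n : {ffun 'I_1 -> 'I_N.+1})
   (\prod_(j < 1) 1 ^+ n j) * \1_(grid_event s (fun j : 'I_1 => n j)) w.
have c1 (j : nat) : `|1 : R| <= 1 by rewrite normr1.
have S1 N w : `|S N w| <= 1 by exact: (@grid_sum_norm_le1 1 s erefl (fun=> 1) c1 N w).
have mA N : measurable [set w | (T N w <= u%:E)%E] by exact: measurable_le_birth.
have mS N : measurable_fun setT (S N).
  apply: measurable_sum => n; apply: measurable_funM => //; apply: measurable_indic.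
  exact: measurable_grid_event.
have pw N w : S N w <= 1 - \1_[set w | (T N w <= u%:E)%E] w.
  have [TN|TN] := boolP (T N w <= u%:E)%E.
    rewrite indicE mem_set// subrr /S big1// => n _.
    rewrite indicE memNset ?mulr0// => -[w0 /(_ ord0)].
    rewrite /= w0 add0e => cn; have := children_count_ge TN.
    by rewrite cn lee_fin ler_nat leqNgt ltn_ord.
  rewrite indicE memNset ?subr0; first exact: le_trans (ler_norm _) (S1 N w).
  exact/negP.
have bd N : 0 <= birth_tail u N <= 1 - \int[P]_w S N w.
  rewrite /birth_tail fine_ge0//= -Rintegral_indic//.
  rewrite lerBrDl -lerBrDr.
  rewrite -[1](Rintegral_cst_prob P).
  have i1 : P.-integrable setT (EFin \o (fun=> 1 : R)).
    by apply: (@bounded_integrable _ _ _ _ _ 1) => // w; rewrite normr1.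
  have iA := integrable_indic_prob P (mA N).
  rewrite -RintegralB//; apply: le_Rintegral => //.
  - exact: (@bounded_integrable _ _ _ _ _ 1).
  - exact: (integrableB measurableT i1 iA).
apply: (@squeeze_cvgr _ _ _ _ (cst 0) (fun N => 1 - \int[P]_w S N w)).
- by near=> N; exact: bd.
- exact: cvg_cst.
- rewrite -(subrr 1); apply: cvgB; first exact: cvg_cst.
  move: cv; under eq_Rintegral do rewrite big_ord1 subrr mulr0 mulr0 oppr0 expR0.
  by rewrite Rintegral_cst_prob.
Unshelve. all: end_near. Qed.

Lemma measurable_birth_prod (u : R) (q : R -> R) M : measurable_fun setT q ->
  measurable_fun setT (birth_prod u q M).
Proof.
move=> mq; apply: measurable_prod => i _; apply: measurable_fun_ifT => //.
  exact: measurable_fun_le_birth.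
apply: measurableT_comp => //; apply: measurableT_comp => //; exact: fine_measurable.
Qed.

Lemma birth_prod_norm_le1 (u : R) (q : R -> R) M w :
  (forall x, `|q x| <= 1) -> `|birth_prod u q M w| <= 1.
Proof. by move=> q1; apply: prod_norm_le1 => i; case: ifP; rewrite ?normr1. Qed.

Lemma birth_prod_stable (u : R) (q : R -> R) M N w : (M <= N)%N -> ~ (T M w <= u%:E)%E ->
  birth_prod u q M w = birth_prod u q N w.
Proof.
move=> /subnKC <- /negP; rewrite -ltNge => uT; rewrite /birth_prod big_split_ord /=.
rewrite [X in _ * X]big1 ?mulr1// => i _; rewrite ifF//; apply/negbTE.
by rewrite -ltNge (lt_le_trans uT)//; apply: T_homo; rewrite leq_addr.
Qed.

Lemma birth_prod_diff (u : R) (q : R -> R) M N : (M <= N)%N -> measurable_fun setT q ->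
  (forall x, `|q x| <= 1) ->
  `|\int[P]_w birth_prod u q M w - \int[P]_w birth_prod u q N w| <= 2 * birth_tail u M.
Proof.
move=> MN mq q1; apply: Rintegral_diff_le.
- exact: measurable_birth_prod.
- exact: measurable_birth_prod.
- by move=> w; exact: birth_prod_norm_le1.
- by move=> w; exact: birth_prod_norm_le1.
- exact: measurable_le_birth.
- by move=> w; exact: birth_prod_stable.
Qed.

(** * Functions constant on the cells of a grid *)

Section grid_pgf.
Variables (m : nat) (s : nat -> R) (c : nat -> R) (q : R -> R).
Hypothesis s0 : s 0%N = 0.
Hypothesis s_homo : {homo s : i j / (i <= j)%N >-> i <= j}.
Hypothesis c1 : forall j, `|c j| <= 1.
Hypothesis mq : measurable_fun setT q.
Hypothesis q1 : forall x, `|q x| <= 1.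
Hypothesis qc : forall j x, s j < x <= s j.+1 -> q x = c j.

(** A point of []0, s m]] lies in exactly one cell, and only the factor of that cell has exponent 1.
    The point 0 lies in no cell, whence the condition on [x]. *)
Lemma cell_prod (x : \bar R) : (0 < x)%E ->
  \prod_(j < m) c j ^+ (((s j)%:E < x) && (x <= (s j.+1)%:E))%E =
  if (x <= (s m)%:E)%E then q (fine x) else 1.
Proof.
move=> x0; elim: m => [|k IH].
  by rewrite big_ord0 s0 ifF//; apply/negbTE; rewrite -ltNge.
rewrite big_ord_recr /= IH ltNge.
have [xk|xk] := boolP (x <= (s k)%:E)%E.
  by rewrite mulr1 ifT// (le_trans xk)// lee_fin; exact: s_homo.
rewrite mul1r /=; case: ifP => xk1; rewrite ?expr0// expr1.
move: x x0 xk xk1 {IH} => [x| |] //=; rewrite -ltNge !lte_fin lee_fin => _ sx xs.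
by apply/esym/qc; rewrite sx.
Qed.

Lemma grid_birth_prod N w : ((s m)%:E < T N w)%E -> children_count T 0 w = 0%E ->
  \prod_(j < m) c j ^+ cell_count s N j w = birth_prod (s m) q N w.
Proof.
move=> sT w0; rewrite /birth_prod.
under [RHS]eq_bigr => i _ do rewrite -(cell_prod (birth_gt0 i w0)).
by rewrite exchange_big; apply: eq_bigr => j _; rewrite prodrXr.
Qed.

Lemma grid_pgf M :
  `|\int[P]_w birth_prod (s m) q M w -
    \int[P]_w expR (- (B w * \sum_(j < m) cell_mass s j * (1 - c j)))|
  <= 2 * birth_tail (s m) M.
Proof.
set a := \int[P]_w expR _.
pose S N w : R := \sum_(n : {ffun 'I_m -> 'I_N.+1})
   (\prod_(j < m) c j ^+ n j) * \1_(grid_event s (fun j : 'I_m => n j)) w.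
have cv : \int[P]_w S N w @[N --> \oo] --> a by exact: grid_expectation_cvg.
have S1 N w : `|S N w| <= 1 by exact: grid_sum_norm_le1.
have mS N : measurable_fun setT (S N).
  apply: measurable_sum => n; apply: measurable_funM => //; apply: measurable_indic.
  exact: measurable_grid_event.
have sm0 : 0 <= s m by rewrite -s0; exact: s_homo.
have m0 : measurable [set w | children_count T 0 w != 0%E].
  rewrite -[X in measurable X]setTI; apply: emeasurable_neq => //.
  exact: measurable_children_count.
have dN N : `|\int[P]_w birth_prod (s m) q N w - \int[P]_w S N w| <= 2 * birth_tail (s m) N.
  (* [grid_birth_prod] does not speak of the null set where a birth occurs at age 0; adding this set
     to the exceptional event leaves the probability unchanged. *)
  have -> : birth_tail (s m) N = fine (P ([set w | (T N w <= (s m)%:E)%E] `|`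
       [set w | children_count T 0 w != 0%E])).
    rewrite /birth_tail measureU0//; first exact: measurable_le_birth.
    exact: children_count0_null.
  apply: Rintegral_diff_le => //.
  - exact: measurable_birth_prod.
  - by move=> w; exact: birth_prod_norm_le1.
  - by apply: measurableU => //; exact: measurable_le_birth.
  - move=> w /not_orP[/negP TN /negP]; rewrite negbK => /eqP w0.
    by rewrite /S grid_pathwise// ?ltNge// grid_birth_prod// ltNge.
apply/ler_addgt0Pr => e e0.
(* Replacing [M] by a large [N] costs the announced bound; passing from the product to [S N] costs
   [2 * (e / 4)] and the limit [e / 2], together [e]. *)
have : \forall N \near \oo, `|a - \int[P]_w S N w| < e / 2.
  by move/cvgrPdist_lt : cv; apply; lra.
have : \forall N \near \oo, birth_tail (s m) N < e / 4.
  have /cvgrPdist_lt/(_ (e / 4)) := birth_tail_cvg0 sm0.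
  have e4 : 0 < e / 4 by lra.
  move=> /(_ e4); apply: filterS => N; rewrite sub0r normrN ger0_norm// /birth_tail.
  exact: fine_ge0.
move=> h1 h2; near \oo => N.
have H1 : birth_tail (s m) N < e / 4 by near: N.
have H2 : `|a - \int[P]_w S N w| < e / 2 by near: N.
have MN : (M <= N)%N by near: N; exact: nbhs_infty_ge.
have H3 := birth_prod_diff (s m) MN mq q1.
have H4 := dN N.
set x := \int[P]_w birth_prod (s m) q M w in H3 *.
set y := \int[P]_w birth_prod (s m) q N w in H3 H4.
set z := \int[P]_w S N w in H2 H4.
have -> : x - a = (x - y) + (y - z) + (z - a) by ring.
apply: (le_trans (ler_normD _ _)); rewrite distrC in H2.
have := ler_normD (x - y) (y - z).
lra.
Unshelve. all: end_near. Qed.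

End grid_pgf.

(** * From step functions to all measurable functions *)

Lemma cuts_pgf (u : R) (q : R -> R) M : 0 <= u -> finite_cuts q ->
  measurable_fun setT q -> (forall x, `|q x| <= 1) ->
  `|\int[P]_w birth_prod u q M w - \int[P]_w expR (- (B w *
      \int[lebesgue_measure]_(x in `[0, u]) (h x * (1 - q x))))|
  <= 2 * birth_tail u M.
Proof.
move=> u0 [l lq] mq q1.
pose L := sort <=%R (0 :: u :: [seq a <- l | 0 <= a <= u]).
have sL : sorted <=%R L by apply: sort_sorted; exact: le_total.
have L0u a : a \in L -> 0 <= a <= u.
  rewrite mem_sort !inE mem_filter => /or3P[/eqP->|/eqP->|/andP[]//].
    by rewrite lexx.
  by rewrite u0 lexx.
(* The default value [u] prolongs the sorted list by its largest element: the grid stays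
   nondecreasing on all of [nat], and the added cells are empty. *)
pose s j := nth u L j.
have s_bd j : 0 <= s j <= u.
  rewrite /s; have [jL|jL] := ltnP j (size L); first by apply: L0u; exact: mem_nth.
  by rewrite nth_default// u0 lexx.
have s_homo : {homo s : i j / (i <= j)%N >-> i <= j}.
  move=> i j ij; rewrite {2}/s; have [jL|jL] := ltnP j (size L).
    by apply: (sorted_leq_nth le_trans le_refl) => //; rewrite inE// (leq_ltn_trans ij).
  by rewrite nth_default//; have /andP[] := s_bd i.
have s_mem a : a \in L -> exists k, a = s k.
  by move=> aL; exists (index a L); rewrite /s nth_index.
have s0 : s 0%N = 0.
  apply/eqP; rewrite eq_le (andP (s_bd 0%N)).1 andbT.
  have [|k ->] := s_mem 0; first by rewrite mem_sort mem_head.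
  exact: s_homo.
have [m sm] : exists m, s m = u.
  by have [|k ->] := s_mem u; [rewrite mem_sort !inE eqxx orbT|exists k].
(* The right end represents its cell, because cuts are compared by [x <= a] and cells are closed on
   the right. A cut [a >= x] of the grid lies above [s j], so its index is at least [j.+1] and [a]
   is at least [s j.+1]. *)
have qc j x : s j < x <= s j.+1 -> q x = q (s j.+1).
  move=> /andP[sx xs]; apply: lq => a al; apply/idP/idP => [xa|]; last exact: le_trans.
  have [ua|au] := ltP u a; first by rewrite (le_trans (andP (s_bd _)).2)// ltW.
  have aL : a \in L.
    rewrite mem_sort !inE mem_filter al au andbT.
    by rewrite (le_trans (andP (s_bd j)).1 (ltW (lt_le_trans sx xa))) !orbT.
  have [k ak] := s_mem _ aL; rewrite ak; apply: (s_homo); rewrite ltnNge.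
  apply/negP => /s_homo; rewrite -ak leNgt => /negP; apply.
  exact: lt_le_trans xa.
rewrite -sm (rate_integral_cells h_loc _ s0 s_homo mq q1 qc).
exact: (@grid_pgf m s (fun j => q (s j.+1)) q).
Qed.

Definition clamp (x : R) : R := Num.max (- 1) (Num.min 1 x).

Lemma clamp_norm_le1 x : `|clamp x| <= 1.
Proof.
rewrite ler_norml le_max lexx /= ge_max ge_min lexx /= andbT; lra.
Qed.

Lemma clamp_id x : `|x| <= 1 -> clamp x = x.
Proof.
rewrite ler_norml => /andP[x1 x2].
by rewrite /clamp (min_idPr x2) (max_idPr x1).
Qed.

Lemma measurable_clamp : measurable_fun setT clamp.
Proof. by apply: measurable_maxr => //; exact: measurable_minr. Qed.

Lemma continuous_clamp : continuous clamp.
Proof.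
have -> : clamp = (fun=> - 1) \max ((fun=> 1) \min id) by [].
move=> x; apply: (@continuous_max R R); first exact: cst_continuous.
apply: (@continuous_min R R); [exact: cst_continuous|exact: cvg_id].
Qed.

(* [clamp] keeps the functions of a Baire derivation bounded, which dominated
   convergence needs. *)
Lemma baire_pgf (u : R) (q : R -> R) M : 0 <= u -> baire q ->
  measurable_fun setT q /\
  `|\int[P]_w birth_prod u (clamp \o q) M w - \int[P]_w expR (- (B w *
      \int[lebesgue_measure]_(x in `[0, u]) (h x * (1 - (clamp \o q) x))))|
  <= 2 * birth_tail u M.
Proof.
move=> u0; elim=> {q} [q cq mq|q_ q _ IH qq].
  split => //; apply: cuts_pgf => //.
  - by case: cq => l lq; exists l => x y /lq; rewrite /= => ->.
  - exact: (measurableT_comp measurable_clamp).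
  - by move=> x; exact: clamp_norm_le1.
have mq_ n : measurable_fun setT (q_ n) by have [] := IH n.
have mq : measurable_fun setT q by apply: measurable_fun_cvg => // x _; exact: qq.
split => //.
have mc_ n : measurable_fun setT (clamp \o q_ n) by exact: (measurableT_comp measurable_clamp).
have cq x : (clamp \o q_ n) x @[n --> \oo] --> (clamp \o q) x.
  by apply: continuous_cvg; [exact: continuous_clamp|exact: qq].
have cv1 : \int[P]_w birth_prod u (clamp \o q_ n) M w @[n --> \oo] -->
    \int[P]_w birth_prod u (clamp \o q) M w.
  apply: (@bounded_cvg_Rintegral _ _ _ P _ _ 1) => [n|n w|w].
  - exact: measurable_birth_prod.
  - by apply: birth_prod_norm_le1 => x; exact: clamp_norm_le1.
  - apply: cvg_prodr => i; case: ifP => _; [exact: cq|exact: cvg_cst].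
have cv2 : \int[P]_w expR (- (B w *
      \int[lebesgue_measure]_(x in `[0, u]) (h x * (1 - (clamp \o q_ n) x)))) @[n --> \oo] -->
    \int[P]_w expR (- (B w *
      \int[lebesgue_measure]_(x in `[0, u]) (h x * (1 - (clamp \o q) x)))).
  apply: (@bounded_cvg_Rintegral _ _ _ P _ _ 1) => [n|n w|w].
  - apply: measurableT_comp; first exact: measurable_expR.
    by apply: measurable_funN; exact: measurable_funM.
  - rewrite ger0_norm ?expR_ge0// -[leRHS]expR0 ler_expR oppr_le0 mulr_ge0//.
    apply: Rintegral_ge0 => x /=; rewrite in_itv /= => /andP[x0 _].
    rewrite mulr_ge0 ?h_ge0// subr_ge0 (le_trans (ler_norm _))//.
    exact: clamp_norm_le1.
  - apply: continuous_cvg; first exact: continuous_expR.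
    apply: cvgN; apply: cvgMr.
    apply: (@rate_integral_cvg _ _ _ _ _ 2) => // [n|n x|x].
    + exact: measurable_funB.
    + rewrite (le_trans (ler_normB _ _))// normr1 (natrD _ 1 1) lerD//.
      exact: clamp_norm_le1.
    + by apply: cvgB; [exact: cvg_cst|exact: cq].
apply: (cvg_norm_le (cvgB cv1 cv2)) => n; exact: (IH n).2.
Qed.

(** Every measurable function has a Baire derivation, and [clamp] is the identity on one bounded by
    1. Finitely many factors are kept because the independence argument of [swap_prod] treats the
    children one at a time. *)
Theorem birth_pgf (u : R) (q : R -> R) M : 0 <= u -> measurable_fun setT q ->
  (forall x, `|q x| <= 1) ->
  `|\int[P]_w birth_prod u q M w - \int[P]_w expR (- (B w *
      \int[lebesgue_measure]_(x in `[0, u]) (h x * (1 - q x))))|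
  <= 2 * birth_tail u M.
Proof.
move=> u0 mq q1; have [_] := baire_pgf M u0 (measurable_baire mq).
by have -> : clamp \o q = q by apply/funext => x; exact: clamp_id.
Qed.

End births.

(** * One generation *)

(** The common shape of the sum inside [phi_tilde], of the recursion for the cluster size and of the
    truncated clusters, so that one transform formula serves the operator and the truncated clusters
    alike. *)
Definition offspring_sum (Omega : Type) (R : realType) (J : Omega -> R)
    (T : nat -> Omega -> \bar R) (X : nat -> R -> Omega -> \bar R) (u : R) (w : Omega) : \bar R :=
  (((u < J w)%R%:R : R)%:E + \sum_(0 <= i <oo | (T i w <= u%:E)%E) X i (u - fine (T i w))%R w)%E.

Section offspring_sum.
Context (R : realType).

Lemma measurable_offspring_sum d (Omega : measurableType d) (J : Omega -> R)
    (T : nat -> Omega -> \bar R) (X : nat -> R -> Omega -> \bar R) :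
  measurable_fun setT J -> (forall i, measurable_fun setT (T i)) ->
  (forall i, measurable_fun setT (fun p : R * Omega => X i p.1 p.2)) ->
  (forall i v w, (0 <= X i v w)%E) ->
  measurable_fun setT (fun p : R * Omega => offspring_sum J T X p.1 p.2).
Proof.
move=> mJ mT mX X0.
have mT' i : measurable_fun setT (fun p : R * Omega => T i p.2).
  by apply: measurableT_comp => //; exact: measurable_snd.
have m1 : measurable_fun setT (fun p : R * Omega => p.1) by exact: measurable_fst.
apply: emeasurable_funD.
  apply/measurable_EFinP.
  rewrite (_ : (fun _ => _) = fun p : R * Omega => if p.1 < J p.2 then 1 else 0); last first.
    by apply/funext => p; case: ifP.
  apply: measurable_fun_ifT => //; apply: measurable_fun_ltr => //.
  by apply: measurableT_comp => //; exact: measurable_snd.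
pose Y i (p : R * Omega) := if (T i p.2 <= p.1%:E)%E then X i (p.1 - fine (T i p.2)) p.2 else 0%E.
rewrite (_ : (fun _ => _) = fun p => (\sum_(0 <= i <oo | i \in predT) Y i p)%E); last first.
  by apply/funext => p; rewrite eseries_mkcond//.
apply: ge0_emeasurable_sum => [i p _ _|i _]; first by rewrite /Y; case: ifP.
apply: measurable_fun_ifT => //.
  by apply: measurable_fun_lee => //; exact/measurable_EFinP.
apply: (measurableT_comp (mX i)
  (g := fun p : R * Omega => (p.1 - fine (T i p.2), p.2))).
apply: measurable_fun_pair; last exact: measurable_snd.
by apply: measurable_funB => //; apply: measurableT_comp => //; exact: fine_measurable.
Qed.

Lemma extended_nat_sum (I : Type) (s : seq I) (p : pred I) (x : I -> \bar R) :
  (forall i, extended_nat (x i)) -> extended_nat (\sum_(i <- s | p i) x i)%E.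
Proof.
move=> xn; apply: big_ind => //; last exact: extended_natD.
exact: (@extended_nat_bool R false).
Qed.

(** If the limit [l] is finite, some partial sum exceeds [l - 1/2]; later partial sums are integers
    between it and [l], hence equal to it, and so is [l]. *)
Lemma extended_nat_series (x : nat -> \bar R) (p : pred nat) :
  (forall i, extended_nat (x i)) -> extended_nat (\sum_(0 <= i <oo | p i) x i)%E.
Proof.
move=> xn; set l := (\sum_(0 <= i <oo | p i) x i)%E.
have x0 i : (0 <= x i)%E by exact: extended_nat_ge0.
have [->|loo] := eqVneq l +oo%E; first by left.
have lfin : l \is a fin_num by rewrite ge0_fin_numE ?lt_neqAle ?loo ?leey//; exact: nneseries_ge0.
have cv := @is_cvg_nneseries R x p 0 (fun i _ _ => x0 i).
have nd : nondecreasing_seq (fun n => (\sum_(0 <= i < n | p i) x i)%E).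
  by apply: lee_sum_nneg_natr => i _ _; exact: x0.
have le_l n : (\sum_(0 <= i < n | p i) x i <= l)%E by exact: nneseries_lim_ge.
have [n ln] : exists n, (l - (1/2)%:E < \sum_(0 <= i < n | p i) x i)%E.
  apply: contrapT => /forallNP h.
  have : (l <= l - (1/2)%:E)%E.
    apply: (lime_le cv); apply: nearW => n.
    by rewrite leNgt; apply/negP; exact: h.
  by rewrite -(fineK lfin) lee_fin; lra.
suff -> : l = (\sum_(0 <= i < n | p i) x i)%E by exact: extended_nat_sum.
apply/eqP; rewrite eq_le le_l andbT.
apply: (lime_le cv); near=> N.
have nN : (n <= N)%N by near: N; exact: nbhs_infty_ge.
have := nd _ _ nN; have := le_l N; move: ln.
have [->|[a ->]] := extended_nat_sum (index_iota 0 n) p xn.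
  by rewrite leye_eq => _ _ /eqP ->.
have [->|[b ->]] := extended_nat_sum (index_iota 0 N) p xn.
  by rewrite leye_eq (negPf loo).
rewrite -(fineK lfin) -EFinB lte_fin !lee_fin !ler_nat => h1 h2 ab.
rewrite leqNgt; apply/negP; rewrite -(ler_nat R) -natr1 => h3.
by lra.
Unshelve. all: end_near. Qed.

Lemma extended_nat_offspring_sum (Omega : Type) (J : Omega -> R)
    (T : nat -> Omega -> \bar R) (X : nat -> R -> Omega -> \bar R) u w :
  (forall i v w, extended_nat (X i v w)) -> extended_nat (offspring_sum J T X u w).
Proof.
move=> Xn; apply: extended_natD; first exact: extended_nat_bool.
by apply: extended_nat_series => i.
Qed.

End offspring_sum.

(** * Measurability with respect to a sub-sigma-algebra *)

Section sub_sigma_algebra.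
Context d (Omega : measurableType d).
Variable G : set (set Omega).
Hypothesis Gm : G `<=` measurable.

(** Viewed as a random element of [Omega] with the sigma-algebra generated by [G], the identity
    carries exactly that information; independence of two sigma-algebras becomes independence of two
    such identities, the form [indep_fubini] asks for. *)
Lemma measurable_id_sigma :
  measurable_fun setT (id : Omega -> g_sigma_algebraType G).
Proof. by move=> _ A GA; rewrite setTI preimage_id; exact: sigma_sub_measurable GA. Qed.

Lemma sigma_measurable_fun d' (E : measurableType d') (f : Omega -> E) :
  measurable_fun [set: g_sigma_algebraType G] f -> measurable_fun [set: Omega] f.
Proof. by move=> mf; exact: (measurableT_comp mf measurable_id_sigma). Qed.

Lemma sigma_measurable_fun_prod d1 d' (U : measurableType d1) (E : measurableType d')
    (f : U * Omega -> E) :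
  measurable_fun [set: U * g_sigma_algebraType G] f -> measurable_fun [set: U * Omega] f.
Proof.
pose e (p : U * Omega) : U * g_sigma_algebraType G := (p.1, p.2).
have me : measurable_fun setT e.
  apply: measurable_fun_pair; first exact: measurable_fst.
  apply: (measurableT_comp measurable_id_sigma); exact: measurable_snd.
have fe : f = f \o e by apply/funext => -[].
by move=> mf; rewrite fe; exact: (measurableT_comp mf me).
Qed.

End sub_sigma_algebra.

(* [X m v] is the contribution of child [m] at age [v]. It is determined by the
   information [G m], while [H m] contains that of the individual itself and of
   its children [j < m]. *)
Section offspring_transform.
Context d (Omega : measurableType d) (R : realType) (P : probability Omega R).
Variables (h : R -> R) (J B : Omega -> R) (T : nat -> Omega -> \bar R).
Hypothesis h_ge0 : forall s, 0 <= s -> 0 <= h s.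
Hypothesis h_loc : locally_integrable_half_line h.
Hypothesis HJBT : individual P h J B T.
Variables (G H : nat -> set (set Omega)) (X : nat -> R -> Omega -> \bar R).
Hypothesis Gm : forall m, G m `<=` measurable.
Hypothesis Hm : forall m, H m `<=` measurable.
Hypothesis GH : forall m, independent_systems P <<s H m>> <<s G m>>.
Hypothesis HJ : forall m, measurable_fun [set: g_sigma_algebraType (H m)] J.
Hypothesis HT : forall m i, measurable_fun [set: g_sigma_algebraType (H m)] (T i).
Hypothesis GX : forall m, measurable_fun [set: R * g_sigma_algebraType (G m)]
  (fun p => X m p.1 p.2).
Hypothesis HX : forall m j, (j < m)%N ->
  measurable_fun [set: R * g_sigma_algebraType (H m)] (fun p => X j p.1 p.2).
Hypothesis Xnat : forall m v w, extended_nat (X m v w).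
Variables (t z : R) (f : R -> R).
Hypothesis z1 : `|z| <= 1.
Hypothesis mf : measurable_fun `[0, t]%classic f.
Hypothesis fX : forall m v, 0 <= v <= t -> \int[P]_w zpow z (X m v w) = f v.
Variable u : R.
Hypothesis ut : 0 <= u <= t.

Let u0 : 0 <= u. Proof. by have /andP[] := ut. Qed.
Let mJ : measurable_fun setT J. Proof. by case: HJBT => -[]. Qed.
Let mB : measurable_fun setT B. Proof. by case: HJBT => -[]. Qed.
Let mT i : measurable_fun setT (T i). Proof. by case: HJBT. Qed.
Let B_ge0 w : 0 <= B w. Proof. by case: HJBT => _ _ []. Qed.
Let T_ge0 w i : (0 <= T i w)%E. Proof. by case: HJBT => _ _ _ /(_ w) []. Qed.
Let T_homo w : {homo T ^~ w : i j / (i <= j)%N >-> (i <= j)%E}.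
Proof. by case: HJBT => _ _ _ /(_ w) []. Qed.
Let BT_poisson : conditionally_poisson P h B T. Proof. by case: HJBT => _ _ _ _ []. Qed.

Let zeta m (tau : \bar R) w : R :=
  if (tau <= u%:E)%E then zpow z (X m (u - fine tau) w) else 1.

(** Extended by 1 outside [[0, u]], because [birth_pgf] wants a measurable function bounded by 1 on
    the whole line. *)
Let q (tau : R) : R := if 0 <= tau <= u then f (u - tau) else 1.

Let zeta1 m tau w : `|zeta m tau w| <= 1.
Proof. by rewrite /zeta; case: ifP => _; rewrite ?normr1//; exact: zpow_norm_le1. Qed.

Let mX m : measurable_fun [set: R * Omega] (fun p => X m p.1 p.2).
Proof.
exact: (sigma_measurable_fun_prod (@Gm m) (@GX m)).
Qed.

Let mXv m v : measurable_fun setT (X m v).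
Proof.
apply: (measurableT_comp (mX m) (g := fun w => (v, w))).
exact: measurable_fun_pair.
Qed.

Let q1 tau : `|q tau| <= 1.
Proof.
rewrite /q; case: ifP => [/andP[t0 tu]|_]; rewrite ?normr1//.
rewrite -(fX 0%N); last first.
  by rewrite subr_ge0 tu /= lerBlDr (le_trans (andP ut).2)// lerDl.
apply: Rintegral_le_bound => [|w]; last exact: zpow_norm_le1.
by apply: measurableT_comp; [exact: measurable_zpow|exact: mXv].
Qed.

Let mq : measurable_fun setT q.
Proof.
have mpf : measurable_fun setT (f \_ `[0, t]%classic).
  by have [mpf _] := measurable_restrictT f (measurable_itv `[0, t]); exact: mpf.
have -> : q = fun tau => if (0 <= tau) && (tau <= u) then (f \_ `[0, t]%classic) (u - tau) else 1.
  apply/funext => tau; rewrite /q; case: ifP => // /andP[t0 tu].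
  rewrite patchE mem_set//= in_itv /= subr_ge0 tu /=.
  by rewrite lerBlDr (le_trans (andP ut).2)// lerDl.
apply: measurable_fun_ifT => //.
  by apply: measurable_and; exact: measurable_fun_ler.
by apply: measurableT_comp => //; exact: measurable_funB.
Qed.

Let bfactor i w : R := if (T i w <= u%:E)%E then q (fine (T i w)) else 1.

(* Independence of [G m] and [H m] allows to average over the process of child
   [m] with its birth time frozen. *)
Let swap m (r : Omega -> R) :
  measurable_fun [set: g_sigma_algebraType (H m)] r -> (forall w, `|r w| <= 1) ->
  \int[P]_w (r w * zeta m (T m w) w) = \int[P]_w (r w * bfactor m w).
Proof.
move=> mr r1.
pose K (p : g_sigma_algebraType (H m) * g_sigma_algebraType (G m)) : R :=
  r p.1 * zeta m (T m p.1) p.2.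
have mK : measurable_fun setT K.
  apply: measurable_funM.
    exact: (measurableT_comp mr measurable_fst).
  have mTm : measurable_fun setT
      (fun p : g_sigma_algebraType (H m) * g_sigma_algebraType (G m) => T m p.1).
    exact: (measurableT_comp (@HT m m) measurable_fst).
  apply: measurable_fun_ifT => //; first exact: measurable_fun_lee.
  apply: measurableT_comp; first exact: measurable_zpow.
  apply: (measurableT_comp (@GX m)
    (g := fun p : g_sigma_algebraType (H m) * g_sigma_algebraType (G m) =>
       (u - fine (T m p.1), p.2))).
  apply: measurable_fun_pair; last exact: measurable_snd.
  by apply: measurable_funB => //; apply: measurableT_comp => //; exact: fine_measurable.
have K1 p : `|K p| <= 1 by rewrite normrM mulr_ile1//; exact: zeta1.
have := @indep_fubini _ _ _ P _ _ (g_sigma_algebraType (H m)) (g_sigma_algebraType (G m)) id id K 1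
  (measurable_id_sigma (@Hm m)) (measurable_id_sigma (@Gm m)) _ mK K1.
rewrite /K /= => ->; last by move=> A1 A2 mA1 mA2; exact: (@GH m).
apply: eq_Rintegral => w _; rewrite RintegralZl//; last first.
  apply: (@bounded_integrable _ _ _ P _ 1) => [|w']; last exact: zeta1.
  rewrite /zeta; case: (T m w <= u%:E)%E => //.
  by apply: measurableT_comp; [exact: measurable_zpow|exact: mXv].
congr (_ * _); rewrite /zeta /bfactor; case: ifPn => Tu; last first.
  by rewrite [LHS](Rintegral_cst_prob P).
have Tfin : T m w \is a fin_num by rewrite ge0_fin_numE// (le_lt_trans Tu)// ltry.
have T0 := T_ge0 w m.
move: Tu T0; rewrite -(fineK Tfin) !lee_fin /= => Tu T0.
rewrite fX /q ?T0 ?Tu//.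
by rewrite subr_ge0 Tu /= lerBlDr (le_trans (andP ut).2)// lerDl.
Qed.

Let Hbfactor m i : measurable_fun [set: g_sigma_algebraType (H m)] (bfactor i).
Proof.
apply: measurable_fun_ifT => //.
  by apply: measurable_fun_lee => //; exact: HT.
apply: (measurableT_comp mq); apply: measurableT_comp; first exact: fine_measurable.
exact: HT.
Qed.

Let bfactor1 i w : `|bfactor i w| <= 1.
Proof. by rewrite /bfactor; case: ifP => _; rewrite ?normr1. Qed.

Let Hzeta m j : (j < m)%N ->
  measurable_fun [set: g_sigma_algebraType (H m)] (fun w => zeta j (T j w) w).
Proof.
move=> jm; apply: measurable_fun_ifT => //.
  by apply: measurable_fun_lee => //; exact: HT.
apply: measurableT_comp; first exact: measurable_zpow.
apply: (measurableT_comp (HX jm)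
  (g := fun w : g_sigma_algebraType (H m) => (u - fine (T j w), w))).
apply: measurable_fun_pair => //; apply: measurable_funB => //.
apply: measurableT_comp; first exact: fine_measurable.
exact: HT.
Qed.

(** The last child goes first: [H N] contains the contributions of the earlier ones, which can thus
    be part of the weight when [swap] treats child [N]. The new factor depends on a birth time only,
    so it is measurable for every [H m] and joins the weight [r] for the induction. *)
Let swap_prod N (r : Omega -> R) :
  (forall m, measurable_fun [set: g_sigma_algebraType (H m)] r) -> (forall w, `|r w| <= 1) ->
  \int[P]_w (r w * \prod_(i < N) zeta i (T i w) w) = \int[P]_w (r w * birth_prod T u q N w).
Proof.
elim: N r => [|N IH] r mr r1.
  by apply: eq_Rintegral => w _; rewrite /birth_prod !big_ord0.
transitivity (\int[P]_w ((r w * \prod_(i < N) zeta i (T i w) w) * zeta N (T N w) w)).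
  by apply: eq_Rintegral => w _; rewrite big_ord_recr /= mulrA.
rewrite (swap (r := fun w => r w * \prod_(i < N) zeta i (T i w) w)); last 2 first.
- apply: measurable_funM; first exact: mr.
  by apply: measurable_prod => i _; apply: Hzeta.
- by move=> w; rewrite normrM mulr_ile1// prod_norm_le1.
transitivity (\int[P]_w ((r w * bfactor N w) * \prod_(i < N) zeta i (T i w) w)).
  by apply: eq_Rintegral => w _; rewrite mulrAC.
rewrite (IH (fun w => r w * bfactor N w)); last 2 first.
- by move=> m; apply: measurable_funM; [exact: mr|exact: Hbfactor].
- by move=> w; rewrite normrM mulr_ile1.
by apply: eq_Rintegral => w _; rewrite /birth_prod big_ord_recr /= mulrAC mulrA.
Qed.

Let alive w : R := zpow z ((u < J w)%R%:R)%:E.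

Let aliveE w : alive w = if u < J w then z else 1.
Proof. by rewrite /alive zpow_nat; case: ifP; rewrite ?expr1 ?expr0. Qed.

Let alive1 w : `|alive w| <= 1. Proof. exact: zpow_norm_le1. Qed.

Let malive d' (Omega' : measurableType d') (J' : Omega' -> R) :
  measurable_fun setT J' -> measurable_fun setT (fun w => zpow z ((u < J' w)%R%:R)%:E).
Proof.
move=> mJ'; apply: measurableT_comp; first exact: measurable_zpow.
apply/measurable_EFinP.
rewrite (_ : (fun _ => _) = fun w => if u < J' w then 1 else 0); last first.
  by apply/funext => w; case: ifP.
by apply: measurable_fun_ifT => //; exact: measurable_fun_ltr.
Qed.

Let alive_mean : \int[P]_w alive w =
  fine (P [set w | J w <= u]) + fine (P [set w | u < J w]) * z.
Proof.
have m1 : measurable [set w | J w <= u].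
  by rewrite -[X in measurable X]setTI; exact: measurable_fun_le.
have m2 : measurable [set w | u < J w].
  rewrite (_ : mkset _ = ~` [set w | J w <= u]); first exact: measurableC.
  by apply/seteqP; split => w /=; rewrite ltNge => /negP.
have ii := @integrable_indic_prob _ _ _ P.
rewrite -!Rintegral_indic// mulrC -RintegralZl//; last exact: ii.
rewrite -RintegralD//; [|exact: ii|exact: (integrableZl measurableT _ (ii _ m2))].
apply: eq_Rintegral => w _; rewrite aliveE !indicE.
case: ltP => uJ; [rewrite memNset ?mem_set//=|rewrite mem_set ?memNset//=].
- by rewrite add0r mulr1.
- by rewrite leNgt uJ.
- by rewrite mulr0 addr0.
- by apply/negP; rewrite -leNgt.
Qed.

(** The product is determined by the births, and [J] is independent of the sigma-algebra of the mark
    and the births, which [S] generates. *)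
Let split_alive N : \int[P]_w (alive w * birth_prod T u q N w) =
  (\int[P]_w alive w) * (\int[P]_w birth_prod T u q N w).
Proof.
pose S := sigma_rv B `|` \bigcup_i sigma_rv (T i).
have Sm : S `<=` measurable.
  move=> A [[C mC <-]|[i _ [C mC <-]]]; rewrite ?setTI.
    by rewrite -[X in measurable X]setTI; exact: mB.
  by rewrite -[X in measurable X]setTI; exact: mT.
have ST i : measurable_fun [set: g_sigma_algebraType S] (T i).
  move=> _ A mA; apply: sub_sigma_algebra; right; exists i => //.
  by exists A.
have Sp : measurable_fun [set: g_sigma_algebraType S] (birth_prod T u q N).
  apply: measurable_prod => i _; apply: measurable_fun_ifT => //.
    by apply: measurable_fun_lee => //; exact: ST.
  apply: (measurableT_comp mq); apply: measurableT_comp; first exact: fine_measurable.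
  exact: ST.
pose a (x : R) : R := if u < x then z else 1.
have ma : measurable_fun setT a by apply: measurable_fun_ifT => //; exact: measurable_fun_ltr.
pose K (p : R * g_sigma_algebraType S) : R := a p.1 * birth_prod T u q N p.2.
have mK : measurable_fun setT K.
  apply: measurable_funM.
    by apply: (measurableT_comp ma); exact: measurable_fst.
  by apply: (measurableT_comp Sp); exact: measurable_snd.
have p1 w : `|birth_prod T u q N w| <= 1 by exact: birth_prod_norm_le1.
have a1 x : `|a x| <= 1 by rewrite /a; case: ifP => _; rewrite ?normr1.
have K1 p : `|K p| <= 1 by rewrite normrM mulr_ile1.
have := @indep_fubini _ _ _ P _ _ R (g_sigma_algebraType S) J id K 1
  mJ (measurable_id_sigma Sm) _ mK K1.
have mp : measurable_fun setT (birth_prod T u q N) := sigma_measurable_fun Sm Sp.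
rewrite /K /= => fub.
have aJ w : alive w = a (J w) by rewrite aliveE.
under eq_Rintegral do rewrite aJ; rewrite fub; last first.
  case: HJBT => _ _ _ _ [_ ind] A1 A2 mA1 mA2; apply: ind; last exact: mA2.
  by exists A1 => //; rewrite setTI.
rewrite -RintegralZr//; last first.
  by apply: (@bounded_integrable _ _ _ P _ 1) => //; exact: malive.
apply: eq_Rintegral => w _; rewrite RintegralZl ?aJ//.
exact: (@bounded_integrable _ _ _ P _ 1).
Qed.

Let partial N w : \bar R :=
  (((u < J w)%R%:R : R)%:E + \sum_(0 <= i < N | (T i w <= u%:E)%E) X i (u - fine (T i w))%R w)%E.

Let zpow_partial N w : zpow z (partial N w) = alive w * \prod_(i < N) zeta i (T i w) w.
Proof.
rewrite /partial zpowD; [|exact: extended_nat_bool|exact: extended_nat_sum].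
congr (_ * _); elim: N => [|N IH].
  by rewrite big_nil big_ord0 (zpow_nat z 0) expr0.
rewrite big_mkcond big_nat_recr//= -big_mkcond big_ord_recr /= -IH /zeta.
case: ifP => _; last by rewrite [X in zpow z X]adde0 mulr1.
by apply: zpowD => //; exact: extended_nat_sum.
Qed.

Let partialE N w : ~ (T N w <= u%:E)%E -> offspring_sum J T X u w = partial N w.
Proof.
move=> /negP; rewrite -ltNge => uT; rewrite /offspring_sum /partial.
rewrite (nneseries_split_cond 0 N) => [|k _]; last by apply: extended_nat_ge0.
rewrite add0n [X in (_ + (_ + X))%E]eseries0 ?adde0// => i Ni Ti.
by move: Ti; rewrite leNgt (lt_le_trans uT)//; exact: T_homo.
Qed.

(** The sum differs from [partial N] only if birth number [N] is in time, which costs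
    [2 * birth_tail]; the exponential formula costs as much again, multiplied by [|A| <= 1]. The
    total, with constant 4, vanishes as [N] grows. *)
Theorem offspring_transform :
  \int[P]_w zpow z (offspring_sum J T X u w) =
  (fine (P [set w | J w <= u]) + fine (P [set w | u < J w]) * z) *
  laplace P B (\int[lebesgue_measure]_(s in `[0, u]) (h s * (1 - f (u - s)))).
Proof.
set rate := \int[lebesgue_measure]_(s in `[0, u]) _.
have rateE : rate = \int[lebesgue_measure]_(s in `[0, u]) (h s * (1 - q s)).
  by apply: eq_Rintegral => s; rewrite inE /= in_itv /= /q => ->.
have laplaceE : laplace P B rate = \int[P]_w expR (- (B w * rate)).
  rewrite /laplace unlock /Rintegral; congr fine; apply: eq_integral => w _.
  by rewrite mulrC.
have mS : measurable_fun setT (offspring_sum J T X u).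
  apply: (measurableT_comp (measurable_offspring_sum mJ mT mX _) (g := fun w => (u, w))).
    by move=> i v w; exact: extended_nat_ge0.
  exact: measurable_fun_pair.
have mzS : measurable_fun setT (fun w => zpow z (offspring_sum J T X u w)).
  by apply: measurableT_comp => //; exact: measurable_zpow.
rewrite -alive_mean laplaceE rateE.
set L := \int[P]_w expR _; set A := \int[P]_w alive w.
have A1 : `|A| <= 1.
  by apply: Rintegral_le_bound => //; exact: malive.
have bound N : `|\int[P]_w zpow z (offspring_sum J T X u w) - A * L| <= 4 * birth_tail P T u N.
  have h1 : `|\int[P]_w zpow z (offspring_sum J T X u w) - \int[P]_w zpow z (partial N w)|
      <= 2 * birth_tail P T u N.
    apply: Rintegral_diff_le => //.
    - rewrite (_ : (fun _ => _) = fun w => alive w * \prod_(i < N) zeta i (T i w) w).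
        apply: measurable_funM; first exact: malive.
        by apply: measurable_prod => i _; exact: (sigma_measurable_fun (@Hm N) (Hzeta _)).
      by apply/funext => w; exact: zpow_partial.
    - by move=> w; exact: zpow_norm_le1.
    - by move=> w; exact: zpow_norm_le1.
    - exact: measurable_le_birth.
    - by move=> w /partialE ->.
  have h2 : \int[P]_w zpow z (partial N w) = A * \int[P]_w birth_prod T u q N w.
    rewrite -split_alive -swap_prod//; last by move=> m; apply: malive; exact: HJ.
    by apply: eq_Rintegral => w _; rewrite zpow_partial.
  have h3 := birth_pgf h_ge0 h_loc mB mT B_ge0 T_homo BT_poisson N u0 mq q1.
  rewrite h2 in h1; rewrite -/L in h3.
  have -> : \int[P]_w zpow z (offspring_sum J T X u w) - A * L =
     (\int[P]_w zpow z (offspring_sum J T X u w) - A * \int[P]_w birth_prod T u q N w) +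
     A * (\int[P]_w birth_prod T u q N w - L) by ring.
  apply: (le_trans (ler_normD _ _)).
  have h4 : `|A * (\int[P]_w birth_prod T u q N w - L)| <= 2 * birth_tail P T u N.
    by rewrite normrM (le_trans _ h3)// ler_piMl.
  have -> : 4 * birth_tail P T u N = 2 * birth_tail P T u N + 2 * birth_tail P T u N by ring.
  exact: lerD.
apply/eqP; rewrite -subr_eq0 -normr_eq0 eq_le normr_ge0 andbT.
have cv := birth_tail_cvg0 h_ge0 mB mT B_ge0 T_homo BT_poisson u0.
have cv4 : 4 * birth_tail P T u N @[N --> \oo] --> 0 by rewrite -(mulr0 4); exact: cvgMr.
rewrite -(cvg_lim _ cv4)//; apply: limr_ge; first by apply/cvg_ex; eexists; exact: cv4.
exact: nearW.
Qed.

End offspring_transform.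

(** * The operator on distributions *)

Section group_measurability.
Context d (Omega : measurableType d) (R : realType).
Variables (I : choiceType) (G : I -> set (set Omega)).

Definition group_system (D : pred I) : set (set Omega) := \bigcup_(i in [set i | D i]) G i.

Lemma group_system_measurable (D : pred I) : (forall i, G i `<=` measurable) ->
  group_system D `<=` measurable.
Proof. by move=> Gm A [i _]; exact: Gm. Qed.

Lemma measurable_fun_group (D : pred I) i d' (E : measurableType d') (f : Omega -> E) :
  D i -> (forall A, measurable A -> G i (f @^-1` A)) ->
  measurable_fun [set: g_sigma_algebraType (group_system D)] f.
Proof.
move=> Di Gf _ A mA; rewrite setTI; apply: sub_sigma_algebra; exists i => //.
exact: Gf.
Qed.

End group_measurability.

Section sigma_rv.
Context d (Omega : measurableType d).

Lemma sigma_rv_sigma_algebra d' (E : measurableType d') (X : Omega -> E) :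
  sigma_algebra setT (sigma_rv X).
Proof. by apply: sigma_algebra_preimage; exact: sigma_algebra_measurable. Qed.

Lemma sigma_rv_measurable d' (E : measurableType d') (X : Omega -> E) :
  measurable_fun setT X -> sigma_rv X `<=` measurable.
Proof. by move=> mX _ [A mA <-]; exact: mX. Qed.

Lemma sigma_rv_preimage d' (E : measurableType d') (X : Omega -> E) A :
  measurable A -> sigma_rv X (X @^-1` A).
Proof. by exists A => //; rewrite setTI. Qed.

Context (R : realType).
Variables (J B : Omega -> R) (T : nat -> Omega -> \bar R).

Lemma sigma_individual_measurable :
  measurable_fun setT J -> measurable_fun setT B -> (forall i, measurable_fun setT (T i)) ->
  sigma_individual J B T `<=` measurable.
Proof.
move=> mJ mB mT; apply: sigma_sub_measurable => A [|[|[i _]]]; exact: sigma_rv_measurable.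
Qed.

Lemma sigma_individual_service A : measurable A -> sigma_individual J B T (J @^-1` A).
Proof. by move=> mA; apply: sub_sigma_algebra; left; exact: sigma_rv_preimage. Qed.

Lemma sigma_individual_birth i A : measurable A -> sigma_individual J B T (T i @^-1` A).
Proof.
by move=> mA; apply: sub_sigma_algebra; right; right; exists i => //; exact: sigma_rv_preimage.
Qed.

End sigma_rv.

(** * Transforms of time-dependent cdfs *)

Section cdf_transform.
Context d (Omega : measurableType d) (R : realType) (P : probability Omega R).
Variables (t : R) (F : R -> nat -> R) (z : R) (f : R -> R).
Hypothesis tdF : td_cdf t F.
Hypothesis z1 : `|z| <= 1.
Hypothesis Ff : forall v, 0 <= v <= t -> has_z_transform (F v) z (f v).

(** The transform is a pointwise limit of polynomials in [z] whose coefficients are measurable in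
    [v], by the second half of [td_cdf]. *)
Lemma measurable_z_transform : measurable_fun `[0, t]%classic f.
Proof.
apply: (@measurable_fun_cvg _ _ _ _ (fun n v => series (fun k => z ^+ k * cdf_mass (F v) k) n)).
- move=> n; rewrite /series /=; apply: measurable_sum => k.
  apply: measurable_funM => //.
  by case: k => [|k] /=; [|apply: measurable_funB]; exact: tdF.2.
- by move=> v; rewrite /= in_itv /=; exact: Ff.
Qed.

Lemma z_transform_mean (X : Omega -> \bar R) v : 0 <= v <= t ->
  measurable_fun setT X -> (forall w, extended_nat (X w)) ->
  (forall k, P [set w | (X w <= (k%:R : R)%:E)%E] = (F v k)%:E) ->
  \int[P]_w zpow z (X w) = f v.
Proof.
move=> vt mX Xn FX; have h1 := has_z_transform_zpow mX Xn FX z1.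
exact: (cvg_unique _ h1 (Ff vt)).
Qed.

End cdf_transform.

(** Measurability in [u] is part of Tonelli's theorem: [F u k] is the probability of the section at
    [u] of a measurable subset of [R * Omega]. *)
Lemma td_cdf_process d (Omega : measurableType d) (R : realType) (P : probability Omega R)
    (t : R) (X : R -> Omega -> \bar R) (F : R -> nat -> R) :
  measurable_fun [set: R * Omega] (fun p => X p.1 p.2) ->
  (forall u w, extended_nat (X u w)) ->
  (forall u k, 0 <= u <= t -> P [set w | (X u w <= (k%:R : R)%:E)%E] = (F u k)%:E) ->
  td_cdf t F.
Proof.
move=> mX Xn FX; split => [u ut|k].
  exists d, Omega, P, (X u); split => //; last by move=> k; rewrite FX.
  by apply: (measurableT_comp mX (g := fun w => (u, w))); exact: measurable_fun_pair.
pose A := [set p : R * Omega | (X p.1 p.2 <= (k%:R : R)%:E)%E].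
have mA : measurable A by rewrite -[X in measurable X]setTI; exact: emeasurable_fun_infty_c.
have := measurable_fun_xsection P mA.
have FE : {in `[0, t]%classic, EFin \o F ^~ k =1 P \o xsection A}.
  move=> u; rewrite inE /= in_itv /= => ut; rewrite -FX//; congr (P _).
  by apply/seteqP; split => w; rewrite /xsection /A /= inE.
move=> mPA; apply/measurable_EFinP; apply: (eq_measurable_fun (P \o xsection A)).
  by move=> u ut; rewrite FE.
exact: measurable_funTS.
Qed.

(** * The action of [phi_tilde] on transforms *)

Section operator.
Context d dE (Omega : measurableType d) (E : measurableType dE) (R : realType).
Context (P : probability Omega R).
Variables (h : R -> R) (t : R) (J B : Omega -> R) (T : nat -> Omega -> \bar R).
Variables (xi : nat -> Omega -> E) (g : (R -> nat -> R) -> R * E -> \bar R).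
Hypothesis h_ge0 : forall s, 0 <= s -> 0 <= h s.
Hypothesis h_loc : locally_integrable_half_line h.
Hypothesis HJBT : individual P h J B T.
Hypothesis Hxi : iid_sources P J B T xi.
Variable F : R -> nat -> R.
Hypothesis Hg : process_with_cdf P xi g t F.
Hypothesis tdF : td_cdf t F.

(** [process_with_cdf] controls [g F] for times in [[0, t]] only. The extension by 0 is measurable
    with extended natural values everywhere, and [phi_tilde] at [u <= t] does not see it, since
    children born by then have ages in [[0, t]]. *)
Let gF (p : R * E) : \bar R := if 0 <= p.1 <= t then g F p else 0%E.

Let mgF : measurable_fun setT gF.
Proof.
have m1 : measurable_fun setT (fun p : R * E => p.1) by exact: measurable_fst.
apply: measurable_fun_if => //.
  by apply: measurable_and; exact: measurable_fun_ler.
rewrite setTI (_ : _ @^-1` _ = `[0, t]%classic `*` [set: E]); first by case: Hg.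
by apply/seteqP; split => -[v x]; rewrite /= in_itv /=; [|case].
Qed.

Let gFE v x : 0 <= v <= t -> gF (v, x) = g F (v, x).
Proof. by rewrite /gF /= => ->. Qed.

Let gF_nat p : extended_nat (gF p).
Proof.
case: p => v x; rewrite /gF /=; case: ifP => [vt|_].
  by case: Hg => _ gn _; exact: gn.
exact: (@extended_nat_bool R false).
Qed.

Let X i v w := gF (v, xi i w).

Let mX d' (Omega' : measurableType d') (xi' : Omega' -> E) : measurable_fun setT xi' ->
  measurable_fun [set: R * Omega'] (fun p => gF (p.1, xi' p.2)).
Proof.
move=> mxi; apply: (measurableT_comp mgF (g := fun p : R * Omega' => (p.1, xi' p.2))).
apply: measurable_fun_pair; first exact: measurable_fst.
by apply: measurableT_comp => //; exact: measurable_snd.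
Qed.

Let X_cdf i v k : 0 <= v <= t -> P [set w | (X i v w <= (k%:R : R)%:E)%E] = (F v k)%:E.
Proof.
move=> vt; case: Hg => _ _ /(_ _ i) <-//; congr (P _).
by apply/seteqP; split => w; rewrite /X /= gFE.
Qed.

Let mxi i : measurable_fun setT (xi i). Proof. by case: Hxi. Qed.
Let mJ : measurable_fun setT J. Proof. by case: HJBT => -[]. Qed.
Let mB : measurable_fun setT B. Proof. by case: HJBT => -[]. Qed.
Let mT i : measurable_fun setT (T i). Proof. by case: HJBT. Qed.

Let fam (o : option nat) : set (set Omega) :=
  if o is Some i then sigma_rv (xi i) else sigma_individual J B T.

Let famm o : fam o `<=` measurable.
Proof.
by case: o => [i|]; [exact: sigma_rv_measurable|exact: sigma_individual_measurable].
Qed.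

Let fams o : sigma_algebra setT (fam o).
Proof.
by case: o => [i|]; [exact: sigma_rv_sigma_algebra|exact: smallest_sigma_algebra].
Qed.

Let phi_tildeE u k : 0 <= u <= t ->
  P [set w | (offspring_sum J T X u w <= (k%:R : R)%:E)%E] = (phi_tilde P J T xi g F u k)%:E.
Proof.
move=> /andP[u0 ut]; rewrite /phi_tilde.
have T0 i w : (0 <= T i w)%E by case: HJBT => _ _ _ /(_ w)[].
rewrite -[X in (fine (P X))%:E](_ : [set w | (offspring_sum J T X u w <= (k%:R : R)%:E)%E] = _).
  rewrite fineK// fin_num_measure// -[X in measurable X]setTI.
  apply: emeasurable_fun_infty_c => //.
  apply: (measurableT_comp (measurable_offspring_sum mJ mT _ _) (g := fun w => (u, w))).
  - by move=> i; exact: mX.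
  - by move=> i v w; apply: extended_nat_ge0; exact: gF_nat.
  - exact: measurable_fun_pair.
suff E' w : offspring_sum J T X u w = (((u < J w)%R%:R : R)%:E +
    \sum_(0 <= i <oo | T i w <= u%:E) g F (u - fine (T i w), xi i w)%R)%E.
  by apply/seteqP; split => w /=; rewrite E'.
rewrite /offspring_sum; congr (_ + _)%E; apply: eq_eseriesr => i Ti.
have Tfin : T i w \is a fin_num by rewrite ge0_fin_numE// (le_lt_trans Ti)// ltry.
have := T0 i w; move: Ti; rewrite -(fineK Tfin) !lee_fin /= => Ti Ti0.
by rewrite /X gFE// subr_ge0 Ti /= (le_trans _ ut)// gerBl.
Qed.

Lemma td_cdf_phi_tilde : td_cdf t (phi_tilde P J T xi g F).
Proof.
apply: (@td_cdf_process _ _ _ P t (offspring_sum J T X)).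
- apply: measurable_offspring_sum => // [i|i v w]; first exact: mX.
  by apply: extended_nat_ge0; exact: gF_nat.
- by move=> u w; apply: extended_nat_offspring_sum => i v w'; exact: gF_nat.
- by move=> u k; exact: phi_tildeE.
Qed.

Theorem phi_tilde_z_transform (f : R -> R -> R) (u z : R) : 0 <= u <= t -> `|z| <= 1 ->
  (forall v, 0 <= v <= t -> has_z_transform (F v) z (f v z)) ->
  has_z_transform (phi_tilde P J T xi g F u) z (phi P h J B f u z).
Proof.
move=> ut z1 Ff.
(* [G m] is the source of child [m] alone; [H m] contains the individual and all other sources. *)
pose G m := group_system fam (pred1 (Some m)).
pose H m := group_system fam (predC1 (Some m)).
have Gm m : G m `<=` measurable by exact: group_system_measurable.
have Hm m : H m `<=` measurable by exact: group_system_measurable.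
have GH m : independent_systems P <<s H m>> <<s G m>>.
  by apply: independent_groups => //; case: Hxi.
have xiH m j (D : pred (option nat)) : D (Some j) ->
    measurable_fun [set: g_sigma_algebraType (group_system fam D)] (xi j).
  by move=> Dj; apply: (measurable_fun_group Dj) => A mA; exact: sigma_rv_preimage.
have HJ m : measurable_fun [set: g_sigma_algebraType (H m)] J.
  by apply: (@measurable_fun_group _ _ _ _ _ None) => // A mA; exact: sigma_individual_service.
have HT m i : measurable_fun [set: g_sigma_algebraType (H m)] (T i).
  by apply: (@measurable_fun_group _ _ _ _ _ None) => // A mA; exact: sigma_individual_birth.
have GX m : measurable_fun [set: R * g_sigma_algebraType (G m)] (fun p => X m p.1 p.2).
  by apply: mX; apply: xiH => //; rewrite /= eqxx.
have HX m j : (j < m)%N ->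
    measurable_fun [set: R * g_sigma_algebraType (H m)] (fun p => X j p.1 p.2).
  move=> jm; apply: mX; apply: xiH => //=.
  by apply/eqP => -[jE]; rewrite jE ltnn in jm.
have Xn m v w : extended_nat (X m v w) by exact: gF_nat.
have mf := measurable_z_transform tdF Ff.
have mXv m v : measurable_fun setT (X m v).
  apply: (measurableT_comp (mX (@mxi m)) (g := fun w => (v, w))).
  exact: measurable_fun_pair.
have fX m v : 0 <= v <= t -> \int[P]_w zpow z (X m v w) = f v z.
  move=> vt; apply: (z_transform_mean (P := P) z1 Ff vt) => // k.
  exact: X_cdf.
have := offspring_transform h_ge0 h_loc HJBT Gm Hm GH HJ HT GX HX Xn z1 mf fX ut.
rewrite /phi => <-.
apply: has_z_transform_zpow => //.
- apply: (measurableT_comp (measurable_offspring_sum mJ mT _ _) (g := fun w => (u, w))).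
  + by move=> i; exact: mX.
  + by move=> i v w; exact: extended_nat_ge0.
  + exact: measurable_fun_pair.
- by move=> w; exact: extended_nat_offspring_sum.
- by move=> k; exact: phi_tildeE.
Qed.

End operator.

(** * Truncated clusters *)

Section cluster_recursion.
Context (Omega : Type) (R : realType).

(** A child born by age [u] has a nonnegative age [v]. Comparing at such [v] only fits the recursion
    of the cluster size, which fails at negative times: nobody has been born then, but the indicator
    of [u < J] is 1. *)
Lemma le_offspring_sum (J : Omega -> R) (T : nat -> Omega -> \bar R)
    (X Y : nat -> R -> Omega -> \bar R) u w :
  (forall i, (0 <= T i w)%E) -> (forall i v, (0 <= X i v w)%E) ->
  (forall i v, 0 <= v -> (X i v w <= Y i v w)%E) ->
  (offspring_sum J T X u w <= offspring_sum J T Y u w)%E.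
Proof.
move=> T0 X0 XY; rewrite leeD2l//; apply: lee_nneseries => [i _ _|i Ti]; first exact: X0.
apply: XY; have Tfin : T i w \is a fin_num by rewrite ge0_fin_numE// (le_lt_trans Ti)// ltry.
by rewrite subr_ge0 -lee_fin fineK.
Qed.

Lemma birth_time_cons d (W : measurableType d) (Tv : seq nat -> nat -> W -> \bar R) i l w :
  birth_time Tv (i :: l) w = (Tv [::] i w + birth_time (fun l' => Tv (i :: l')) l w)%E.
Proof. by rewrite /birth_time /= big_nat_recl. Qed.

End cluster_recursion.

Section cluster_size.
Context d (Omega : measurableType d) (R : realType).
Implicit Types (Jv : seq nat -> Omega -> R) (Tv : seq nat -> nat -> Omega -> \bar R).

Lemma birth_time_ge0 Tv v w : (forall l i, (0 <= Tv l i w)%E) -> (0 <= birth_time Tv v w)%E.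
Proof. by move=> T0; apply: sume_ge0. Qed.

Lemma in_system_cons Jv Tv i l (u : R) w : (forall l i, (0 <= Tv l i w)%E) ->
  in_system Jv Tv (i :: l) u w =
  (Tv [::] i w <= u%:E)%E &&
  in_system (fun l' => Jv (i :: l')) (fun l' => Tv (i :: l')) l (u - fine (Tv [::] i w)) w.
Proof.
move=> T0; rewrite /in_system birth_time_cons.
have b0 : (0 <= birth_time (fun l' => Tv (i :: l')) l w)%E by exact: birth_time_ge0.
set b := birth_time _ l w in b0 *; set x := Tv [::] i w.
have x0 : (0 <= x)%E := T0 _ _.
have [xu|ux] := boolP (x <= u%:E)%E; last first.
  apply/negbTE; rewrite negb_and -ltNge; apply/orP; left.
  by rewrite (lt_le_trans _ (leeDl _ b0))// ltNge.
have xfin : x \is a fin_num by rewrite ge0_fin_numE// (le_lt_trans xu)// ltry.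
rewrite /= -(fineK xfin) /= EFinB.
case: b b0 => [b| |] //= _.
  by rewrite -!EFinD !lee_fin !lte_fin lerBrDl ltrBlDl addrA.
Qed.

(** The labels split into the empty one and, for each [i], those starting with [i], and the
    nonnegative sum splits accordingly. The identity holds at every [w] rather than in law, which
    allows pathwise comparison with the truncated clusters. *)
Lemma cluster_size_rec Jv Tv (u : R) w : 0 <= u -> (forall l i, (0 <= Tv l i w)%E) ->
  cluster_size Jv Tv u w = offspring_sum (Jv [::]) (Tv [::])
    (fun i => cluster_size (fun l => Jv (i :: l)) (fun l => Tv (i :: l))) u w.
Proof.
move=> u0 T0; rewrite /cluster_size /offspring_sum.
rewrite (esumID [set [::]]) ?setTI// esum_set1//; congr (_ + _)%E.
  by rewrite /in_system /birth_time big_geq// lee_fin u0 add0e lte_fin.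
rewrite [X in (\esum_(i in X) _)%E](_ : _ = \bigcup_(i in [set: nat]) (cons i @` [set: seq nat])).
  rewrite esum_bigcupT//; last first.
    apply/trivIsetP => i j _ _ ij; rewrite -subset0 => _ [[l _ <-]] [l' _ [ji _]].
    by move/eqP: ij; apply.
  rewrite -nneseries_esumT; last by move=> i; exact: esum_ge0.
  rewrite [RHS]eseries_mkcond; apply: eq_eseriesr => i _.
  rewrite (esum_image [set: seq nat] (cons i)); last by move=> l l' _ _ [].
  case: ifPn => Ti; last first.
    by rewrite esum1// => l _; rewrite in_system_cons// (negbTE Ti).
  by apply: eq_esum => l _; rewrite in_system_cons// Ti.
apply/seteqP; split => [[|i l]//= _|_ [i _ [l _ <-]]//].
by exists i => //; exists l.
Qed.

(* The descendants of [v] after [n] generations are not followed up: each of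
   them born in time counts for [c]. *)
Fixpoint truncated_cluster Jv Tv (c : \bar R) (n : nat) (v : seq nat) : R -> Omega -> \bar R :=
  if n is n'.+1 then
    offspring_sum (Jv v) (Tv v) (fun i => truncated_cluster Jv Tv c n' (rcons v i))
  else fun _ _ => c.

Lemma extended_nat_truncated_cluster Jv Tv c n v u w : extended_nat c ->
  extended_nat (truncated_cluster Jv Tv c n v u w).
Proof.
move=> cn; elim: n v u w => [//|n IH] v u w /=.
by apply: extended_nat_offspring_sum => i u' w'; exact: IH.
Qed.

Section monotonicity.
Variables (Jv : seq nat -> Omega -> R) (Tv : seq nat -> nat -> Omega -> \bar R).
Hypothesis T0 : forall v i w, (0 <= Tv v i w)%E.

(* The labels of the cluster started by [v] are those of the form [v ++ l]. *)
Let sub_size v := cluster_size (fun l => Jv (v ++ l)) (fun l => Tv (v ++ l)).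

Let sub_sizeE v u w : 0 <= u ->
  sub_size v u w = offspring_sum (Jv v) (Tv v) (fun i => sub_size (rcons v i)) u w.
Proof.
have JE i : (fun l => Jv (v ++ i :: l)) = (fun l => Jv (rcons v i ++ l)).
  by apply/funext => l; rewrite cat_rcons.
have TE i : (fun l => Tv (v ++ i :: l)) = (fun l => Tv (rcons v i ++ l)).
  by apply/funext => l; rewrite cat_rcons.
move=> u0; rewrite /sub_size cluster_size_rec// cats0 /offspring_sum.
by congr (_ + _)%E; apply: eq_eseriesr => i _; rewrite JE TE.
Qed.

Let c0 : @extended_nat R 0%E := @extended_nat_bool R false.
Let coo : @extended_nat R +oo%E. Proof. by left. Qed.

Lemma truncated_cluster0_le v n u w : 0 <= u ->
  (truncated_cluster Jv Tv 0 n v u w <= sub_size v u w)%E.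
Proof.
elim: n v u => [|n IH] v u u0 /=; first exact: esum_ge0.
rewrite sub_sizeE//; apply: le_offspring_sum => // [i u'|i u' u'0]; last exact: IH.
exact/extended_nat_ge0/extended_nat_truncated_cluster.
Qed.

Lemma truncated_clustery_ge v n u w : 0 <= u ->
  (sub_size v u w <= truncated_cluster Jv Tv +oo n v u w)%E.
Proof.
elim: n v u => [|n IH] v u u0 /=; first by rewrite leey.
rewrite sub_sizeE//; apply: le_offspring_sum => // [i u'|i u' u'0]; last exact: IH.
exact: esum_ge0.
Qed.

Lemma truncated_cluster0_nd v n u w :
  (truncated_cluster Jv Tv 0 n v u w <= truncated_cluster Jv Tv 0 n.+1 v u w)%E.
Proof.
have tn k v' u' : (0 <= truncated_cluster Jv Tv 0 k v' u' w)%E.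
  exact/extended_nat_ge0/extended_nat_truncated_cluster.
elim: n v u => [|n IH] v u; first exact: (tn 1%N).
by apply: le_offspring_sum => [i|i u'|i u' _]; [exact: T0|exact: tn|exact: IH].
Qed.

Lemma truncated_clustery_ni v n u w :
  (truncated_cluster Jv Tv +oo n.+1 v u w <= truncated_cluster Jv Tv +oo n v u w)%E.
Proof.
have tn k v' u' : (0 <= truncated_cluster Jv Tv +oo k v' u' w)%E.
  exact/extended_nat_ge0/extended_nat_truncated_cluster.
elim: n v u => [|n IH] v u; first by rewrite leey.
by apply: le_offspring_sum => [i|i u'|i u' _]; [exact: T0|exact: (tn n.+1)|exact: IH].
Qed.

Lemma measurable_cluster_size u : (forall v, measurable_fun setT (Jv v)) ->
  (forall v i, measurable_fun setT (Tv v i)) ->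
  measurable_fun setT (cluster_size Jv Tv u).
Proof.
move=> mJ mT.
have mb v : measurable_fun setT (birth_time Tv v).
  by apply: emeasurable_sum => j.
have ma v : measurable_fun setT (fun w => ((in_system Jv Tv v u w)%:R : R)%:E).
  apply/measurable_EFinP.
  rewrite (_ : (fun _ => _) = fun w => if in_system Jv Tv v u w then 1 else 0); last first.
    by apply/funext => w; case: ifP.
  apply: measurable_fun_ifT => //; apply: measurable_and.
    exact: measurable_fun_lee.
  apply: measurable_fun_lte => //; apply: emeasurable_funD => //.
  exact/measurable_EFinP.
pose a n w := if unpickle n is Some v then ((in_system Jv Tv v u w)%:R : R)%:E else 0%E.
(* The sum over labels becomes a series over codes; [Q] keeps those in the image of [pickle], so
   that each label is counted once. *)
pose Q : pred nat := fun n => if unpickle n is Some v then pickle (v : seq nat) == n else false.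
have a0 n w : (0 <= a n w)%E by rewrite /a; case: unpickle.
rewrite (_ : cluster_size Jv Tv u = fun w => (\sum_(0 <= n <oo | n \in Q) a n w)%E).
  apply: ge0_emeasurable_sum => // n _; rewrite /a; case: unpickle => [v|//].
  exact: ma.
apply/funext => w; rewrite nneseries_esum// /cluster_size.
rewrite (_ : [set n | n \in Q] = pickle @` [set: seq nat]).
  rewrite esum_image; last by move=> l l' _ _; exact: (pcan_inj pickleK).
  by apply: eq_esum => v _; rewrite /a pickleK.
apply/seteqP; split => [n|_ [v _ <-]]; rewrite /mkset unfold_in.
  by move=> /eqP <-; eexists.
by have /= [->] := pickleK v.
Qed.

End monotonicity.
End cluster_size.

(** * Dependence on the laws of mark and service requirement *)

Section same_law.
Context d (Omega : measurableType d) (R : realType) (P : probability Omega R).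

Lemma same_law_laplace (X Y : Omega -> R) (s : R) :
  measurable_fun setT X -> measurable_fun setT Y -> same_law P X Y ->
  laplace P X s = laplace P Y s.
Proof.
move=> mX mY XY.
have E (Z : Omega -> R) (mZ : measurable_fun setT Z) : laplace P Z s =
    fine (\int[pushforward P Z]_x (expR (- (s * x)))%:E)%E.
  rewrite /laplace unlock ge0_integral_pushforward//.
  apply/measurable_EFinP; apply: measurableT_comp; first exact: measurable_expR.
  by apply: measurable_funN; exact: measurable_funM.
rewrite !E//; congr fine.
pose X' : {mfun Omega >-> R} := HB.pack X (isMeasurableFun.Build _ _ _ _ X mX).
pose Y' : {mfun Omega >-> R} := HB.pack Y (isMeasurableFun.Build _ _ _ _ Y mY).
apply: (@eq_measure_integral _ _ _ _ (distribution P Y') (distribution P X')) => A mA _.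
exact: XY.
Qed.

(** Each member of the cluster has its own mark and service requirement, but [phi] depends on their
    laws only, which are those of [B] and [J]. *)
Lemma same_law_phi (h : R -> R) (J J' B B' : Omega -> R) (f : R -> R -> R) (u z : R) :
  measurable_fun setT B -> measurable_fun setT B' ->
  same_law P J J' -> same_law P B B' ->
  phi P h J B f u z = phi P h J' B' f u z.
Proof.
move=> mB mB' JJ BB; rewrite /phi (same_law_laplace _ mB mB' BB).
have := JJ `]-oo, u]%classic (measurable_itv _).
have := JJ `]u, +oo[%classic (measurable_itv _).
have E1 (Z : Omega -> R) : Z @^-1` `]u, +oo[%classic = [set w | u < Z w].
  by apply/seteqP; split => w; rewrite /= in_itv /= andbT.
have E2 (Z : Omega -> R) : Z @^-1` `]-oo, u]%classic = [set w | Z w <= u].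
  by apply/seteqP; split => w; rewrite /= in_itv.
by rewrite !E1 !E2 => -> ->.
Qed.

End same_law.

(** * Transforms of the truncated clusters *)

Section cluster_transform.
Context d (Omega : measurableType d) (R : realType) (P : probability Omega R).
Variables (h : R -> R) (t : R) (J B : Omega -> R).
Variables (Jv Bv : seq nat -> Omega -> R) (Tv : seq nat -> nat -> Omega -> \bar R).
Hypothesis h_ge0 : forall s, 0 <= s -> 0 <= h s.
Hypothesis h_loc : locally_integrable_half_line h.
Hypothesis mB : measurable_fun setT B.
Hypothesis Hcluster : cluster P h J B Jv Bv Tv.
Variable c : \bar R.
Hypothesis cnat : extended_nat c.

Let fam v := sigma_individual (Jv v) (Bv v) (Tv v).

Let ind v : individual P h (Jv v) (Bv v) (Tv v). Proof. by case: Hcluster. Qed.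
Let mJv v : measurable_fun setT (Jv v). Proof. by case: (ind v) => -[]. Qed.
Let mBv v : measurable_fun setT (Bv v). Proof. by case: (ind v) => -[]. Qed.
Let mTv v i : measurable_fun setT (Tv v i). Proof. by case: (ind v). Qed.

Let famm v : fam v `<=` measurable. Proof. exact: sigma_individual_measurable. Qed.
Let fams v : sigma_algebra setT (fam v). Proof. exact: smallest_sigma_algebra. Qed.

Let Y := truncated_cluster Jv Tv c.

Let Ynat n v u w : extended_nat (Y n v u w).
Proof. exact: extended_nat_truncated_cluster. Qed.

(** Only labels extending [v] enter. The group [D] may be larger, because the induction passes from
    [v] to its children with [D] unchanged. *)
Lemma measurable_truncated_cluster_group n v (D : pred (seq nat)) :
  (forall l, prefix v l -> D l) ->
  measurable_fun [set: R * g_sigma_algebraType (group_system fam D)] (fun p => Y n v p.1 p.2).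
Proof.
elim: n v D => [|n IH] v D vD; first exact: measurable_cst.
apply: measurable_offspring_sum => [|i|i|i u w].
- by apply: (measurable_fun_group (vD v (prefix_refl v))) => A; exact: sigma_individual_service.
- by apply: (measurable_fun_group (vD v (prefix_refl v))) => A; exact: sigma_individual_birth.
- apply: IH => l /prefixP[s ->]; apply: vD; rewrite cat_rcons; exact: prefix_prefix.
- exact/extended_nat_ge0/Ynat.
Qed.

Lemma measurable_truncated_cluster n v :
  measurable_fun [set: R * Omega] (fun p => Y n v p.1 p.2).
Proof.
have mD := @group_system_measurable _ _ _ fam predT famm.
exact: (sigma_measurable_fun_prod mD (measurable_truncated_cluster_group n (fun _ _ => isT))).
Qed.

Variables (F : R -> nat -> R) (n : nat).
Hypothesis tdF : td_cdf t F.
Hypothesis YF : forall v u k, 0 <= u <= t ->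
  P [set w | (Y n v u w <= (k%:R : R)%:E)%E] = (F u k)%:E.

Theorem truncated_cluster_transform (f : R -> R -> R) (v : seq nat) (u z : R) :
  0 <= u <= t -> `|z| <= 1 ->
  (forall u', 0 <= u' <= t -> has_z_transform (F u') z (f u' z)) ->
  \int[P]_w zpow z (Y n.+1 v u w) = phi P h J B f u z.
Proof.
move=> ut z1 Ff.
(* [G m] is the subtree of child [m]; [H m] is everything else: [v] itself, the subtrees of its
   other children and all individuals not descending from [v]. *)
pose G m := group_system fam [pred l | prefix (rcons v m) l].
pose H m := group_system fam [pred l | ~~ prefix (rcons v m) l].
have Gm m : G m `<=` measurable by exact: group_system_measurable.
have Hm m : H m `<=` measurable by exact: group_system_measurable.
have GH m : independent_systems P <<s H m>> <<s G m>>.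
  by apply: independent_groups => //; case: Hcluster.
have vH m : [pred l | ~~ prefix (rcons v m) l] v.
  apply/prefixP => -[s /(congr1 size)]; rewrite size_cat size_rcons.
  by move/eqP; rewrite addSn -addnS -[X in X == _]addn0 eqn_add2l.
have HJ m : measurable_fun [set: g_sigma_algebraType (H m)] (Jv v).
  by apply: (measurable_fun_group (vH m)) => A; exact: sigma_individual_service.
have HT m i : measurable_fun [set: g_sigma_algebraType (H m)] (Tv v i).
  by apply: (measurable_fun_group (vH m)) => A; exact: sigma_individual_birth.
have GX m : measurable_fun [set: R * g_sigma_algebraType (G m)]
    (fun p => Y n (rcons v m) p.1 p.2).
  exact: measurable_truncated_cluster_group.
have HX m j : (j < m)%N -> measurable_fun [set: R * g_sigma_algebraType (H m)]
    (fun p => Y n (rcons v j) p.1 p.2).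
  move=> jm; apply: measurable_truncated_cluster_group => l /prefixP[s ->].
  apply/prefixP => -[s' /eqP]; rewrite eqseq_cat ?size_rcons// eqseq_rcons eqxx /=.
  by move=> /andP[/eqP jE _]; rewrite jE ltnn in jm.
have Xn m u' w : extended_nat (Y n (rcons v m) u' w) by exact: Ynat.
have mf := measurable_z_transform tdF Ff.
have fX m u' : 0 <= u' <= t -> \int[P]_w zpow z (Y n (rcons v m) u' w) = f u' z.
  move=> ut'; apply: (z_transform_mean (P := P) z1 Ff ut') => // [|k]; last exact: YF.
  apply: (measurableT_comp (measurable_truncated_cluster n (rcons v m)) (g := fun w => (u', w))).
  exact: measurable_fun_pair.
have := offspring_transform h_ge0 h_loc (ind v) Gm Hm GH HJ HT GX HX Xn z1 mf fX ut.
have [Jl Bl] : same_law P (Jv v) J /\ same_law P (Bv v) B by case: Hcluster.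
by rewrite -(same_law_phi h f u z (mBv v) mB Jl Bl).
Qed.

End cluster_transform.

(** * Identification of the iterates *)

Section iteration.
Context (R : realType) (d dE : measure_display).
Context (Omega : measurableType d) (E : measurableType dE) (P : probability Omega R).
Variables (h : R -> R) (t : R).
Variables (J B : Omega -> R) (T : nat -> Omega -> \bar R).
Variables (Jv Bv : seq nat -> Omega -> R) (Tv : seq nat -> nat -> Omega -> \bar R).
Variables (xi : nat -> Omega -> E) (g : (R -> nat -> R) -> R * E -> \bar R).
Hypothesis h_ge0 : forall s, 0 <= s -> 0 <= h s.
Hypothesis h_loc : locally_integrable_half_line h.
Hypothesis HJBT : individual P h J B T.
Hypothesis Hcluster : cluster P h J B Jv Bv Tv.
Hypothesis Hxi : iid_sources P J B T xi.
Hypothesis Hg : forall F : R -> nat -> R, td_cdf t F -> process_with_cdf P xi g t F.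

(** The three claims support each other: [td_cdf] provides the process for the next application of
    [phi_tilde], [phi] carries the transforms along, and equal transforms identify the cdf of the
    next truncated cluster. The last claim is made at all labels [v], since a step at [v] uses its
    children. Both chains are instances: [a = 1] with [c = 0], and [a = 0] with [c = +oo]. *)
Lemma iterates_truncated_cluster (a : R) (c : \bar R) : extended_nat c ->
  (forall k, P [set w | (c <= (k%:R : R)%:E)%E] = a%:E) ->
  forall n : nat, let F := iter n (phi_tilde P J T xi g) (fun _ _ => a) in
  [/\ td_cdf t F,
      forall u z, 0 <= u <= t -> `|z| <= 1 ->
        has_z_transform (F u) z (iter n (phi P h J B) (fun _ _ => a) u z)
    & forall v u k, 0 <= u <= t ->
        P [set w | (truncated_cluster Jv Tv c n v u w <= (k%:R : R)%:E)%E] = (F u k)%:E].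
Proof.
move=> cn ca; have mB : measurable_fun setT B by case: HJBT => -[].
elim=> [|n [tdF zF YF]] /=.
  split=> [|u z ut z1|v u k ut]; last exact: ca.
    by apply: (@td_cdf_process _ _ _ P t (fun _ _ => c)) => //; exact: measurable_cst.
  (* All the mass of the constant cdf [a] sits at 0, so the partial sums equal [a] from the first
     term on. *)
  apply: cvg_near_cst; near=> n.
  have n0 : (0 < n)%N by near: n; exact: nbhs_infty_gt.
  rewrite -(prednK n0) seriesEord /= big_ord_recl expr0 mul1r big1 ?addr0// => k _.
  by rewrite /= subrr mulr0.
set F := iter n _ _ in tdF zF YF *; set f := iter n _ _ in zF *.
have tdF' := td_cdf_phi_tilde HJBT Hxi (Hg tdF).
have zF' u z : 0 <= u <= t -> `|z| <= 1 ->
    has_z_transform (phi_tilde P J T xi g F u) z (phi P h J B f u z).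
  move=> ut z1; apply: (phi_tilde_z_transform h_ge0 h_loc HJBT Hxi (Hg tdF) tdF ut z1).
  by move=> v vt; exact: zF.
split => // v u k ut.
pose Y := truncated_cluster Jv Tv c n.+1 v u.
have mY : measurable_fun setT Y.
  apply: (measurableT_comp (measurable_truncated_cluster Hcluster cn n.+1 v)
    (g := fun w => (u, w))).
  exact: measurable_fun_pair.
have Yn w : extended_nat (Y w) by exact: extended_nat_truncated_cluster.
pose G k := fine (P [set w | (Y w <= (k%:R : R)%:E)%E]).
have YG k' : P [set w | (Y w <= (k'%:R : R)%:E)%E] = (G k')%:E.
  rewrite fineK// fin_num_measure// -[X in measurable X]setTI.
  exact: emeasurable_fun_infty_c.
rewrite [LHS]YG; congr (_%:E).
suff : G =1 phi_tilde P J T xi g F u by exact.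
apply: z_transform_inj => [k'|k'|z /andP[z0 z1]].
- exact: (cdf_mass_itv mY Yn YG).
- by have [d1 [W [Q [X [mX Xn FX]]]]] := tdF'.1 u ut; apply: (cdf_mass_itv mX Xn) => k1.
- have zn : `|z| <= 1 by rewrite ger0_norm ltW.
  exists (phi P h J B f u z); last exact: zF'.
  rewrite -(truncated_cluster_transform h_ge0 h_loc mB Hcluster cn tdF YF v ut zn).
    exact: has_z_transform_zpow.
  by move=> u' ut'; exact: zF.
Unshelve. all: end_near. Qed.

End iteration.

(** * The chain of inequalities *)

Theorem proposition4p2
  (R : realType) (d dE : measure_display)
  (Omega : measurableType d) (E : measurableType dE) (P : probability Omega R)
  (h : R -> R) (t : R)
  (J B : Omega -> R) (T : nat -> Omega -> \bar R)
  (Jv Bv : seq nat -> Omega -> R) (Tv : seq nat -> nat -> Omega -> \bar R)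
  (xi : nat -> Omega -> E) (g : (R -> nat -> R) -> R * E -> \bar R)
  (h_ge0 : forall s, 0 <= s -> 0 <= h s)
  (h_loc : locally_integrable_half_line h)
  (t_gt0 : 0 < t)
  (HJBT : individual P h J B T)
  (Hcluster : cluster P h J B Jv Bv Tv)
  (Hxi : iid_sources P J B T xi)
  (Hg : forall F : R -> nat -> R, td_cdf t F -> process_with_cdf P xi g t F) :
  let F := cluster_cdf P Jv Tv in
  let Phi_tilde := phi_tilde P J T xi g in
  let Phi := phi P h J B in
  let F_up (n : nat) := iter n Phi_tilde (fun _ _ => 1) in
  let F_low (n : nat) := iter n Phi_tilde (fun _ _ => 0) in
  (forall (u : R) (n k : nat), 0 <= u <= t ->
     [/\ 1 = F_up 0%N u k,
         F_up 0%N u k >= F_up n u k,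
         F_up n u k >= F_up n.+1 u k,
         F_up n.+1 u k >= F u k
       & [/\ F u k >= F_low n.+1 u k,
             F_low n.+1 u k >= F_low n u k,
             F_low n u k >= F_low 0%N u k
           & F_low 0%N u k = 0]]) /\
  (forall n : nat,
     [/\ td_cdf t (F_up n), td_cdf t (F_low n)
       & forall u z : R, 0 <= u <= t -> -1 <= z <= 1 ->
           has_z_transform (F_up n u) z (iter n Phi (fun _ _ => 1) u z) /\
           has_z_transform (F_low n u) z (iter n Phi (fun _ _ => 0) u z)]).
Proof.
move=> F Phi_tilde Phi F_up F_low.
have c0 : @extended_nat R 0%E := @extended_nat_bool R false.
have coo : @extended_nat R +oo%E by left.
have P1 k : P [set w | (0 <= (k%:R : R)%:E)%E] = 1%E.
  rewrite (_ : mkset _ = setT); first exact: probability_setT.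
  by apply/seteqP; split => // w _; rewrite /= lee_fin.
have P0 k : P [set w | (+oo <= (k%:R : R)%:E)%E] = 0%E.
  by rewrite (_ : mkset _ = set0) ?measure0//; apply/seteqP; split.
have up := iterates_truncated_cluster h_ge0 h_loc HJBT Hcluster Hxi Hg c0 P1.
have low := iterates_truncated_cluster h_ge0 h_loc HJBT Hcluster Hxi Hg coo P0.
have mJv v : measurable_fun setT (Jv v) by case: Hcluster => /(_ v) [[]].
have mTv v i : measurable_fun setT (Tv v i) by case: Hcluster => /(_ v) [].
have T0 v i w : (0 <= Tv v i w)%E by case: Hcluster => /(_ v) [_ _ _ /(_ w) []].
have mevent (X : Omega -> \bar R) k : measurable_fun setT X ->
    measurable [set w | (X w <= (k%:R : R)%:E)%E].
  by move=> mX; rewrite -[X in measurable X]setTI; exact: emeasurable_fun_infty_c.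
have mY c n u : extended_nat c -> measurable_fun setT (truncated_cluster Jv Tv c n [::] u).
  move=> cn.
  apply: (measurableT_comp (measurable_truncated_cluster Hcluster cn n [::])
    (g := fun w => (u, w))).
  exact: measurable_fun_pair.
have mS u := measurable_cluster_size u mJv mTv.
(* A pathwise larger count has the smaller cdf, so truncation with [+oo] yields the lower bounds. *)
have cdf_le (X Y : Omega -> \bar R) k : measurable_fun setT X -> measurable_fun setT Y ->
    (forall w, (X w <= Y w)%E) ->
    fine (P [set w | (Y w <= (k%:R : R)%:E)%E]) <= fine (P [set w | (X w <= (k%:R : R)%:E)%E]).
  move=> mX mY' XY; have [e1 e2] := (mevent X k mX, mevent Y k mY').
  rewrite fine_le ?fin_num_measure//; apply: le_measure; rewrite ?inE//.
  by move=> w /=; exact: le_trans.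
have FupE n u k : 0 <= u <= t -> F_up n u k =
    fine (P [set w | (truncated_cluster Jv Tv 0 n [::] u w <= (k%:R : R)%:E)%E]).
  by move=> ut; have [_ _ ->] := up n.
have FlowE n u k : 0 <= u <= t -> F_low n u k =
    fine (P [set w | (truncated_cluster Jv Tv +oo n [::] u w <= (k%:R : R)%:E)%E]).
  by move=> ut; have [_ _ ->] := low n.
split => [u n k ut|n]; last first.
  have [up1 up2 _] := up n; have [low1 low2 _] := low n; split => // u z ut z1.
  by split; [apply: up2|apply: low2] => //; rewrite ler_norml.
have [u0 _] := andP ut.
have dec m : F_up m.+1 u k <= F_up m u k.
  by rewrite !FupE//; apply: cdf_le => [||w]; [exact: mY|exact: mY|exact: truncated_cluster0_nd].
have inc m : F_low m u k <= F_low m.+1 u k.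
  by rewrite !FlowE//; apply: cdf_le => [||w]; [exact: mY|exact: mY|exact: truncated_clustery_ni].
split => //; last split => //.
- by elim: n => [|n IH]; [exact: lexx|exact: le_trans (dec n) IH].
- rewrite FupE//; apply: cdf_le => [||w]; [exact: mY|exact: mS|].
  exact: (truncated_cluster0_le Jv T0 [::] n.+1 w u0).
- rewrite FlowE//; apply: cdf_le => [||w]; [exact: mS|exact: mY|].
  exact: (truncated_clustery_ge Jv T0 [::] n.+1 w u0).
- by elim: n => [|n IH]; [exact: lexx|exact: le_trans IH (inc n)].
Qed.
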